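(* Let $(M,g)$ be a Riemannian manifold and set $\mathcal{N}_p=\frac{g^{p-1}\mathrm{Ric}}{(p-1)!}-2\frac{g^{p-2}R}{(p-2)!}$ for $p\geq2$, $\mathcal{N}_1=\mathrm{Ric}$ and $\mathcal{N}_0=0$. For a $(p,q)$ double form $\omega$, the Weitzenböck formula corresponding to the Lichnérowicz Laplacian on double forms takes the form $$\Delta_L(\omega)=\nabla^*\nabla(\omega)+\frac12\bigl(\omega\circ\mathcal{N}_p+\mathcal{N}_q\circ\omega\bigr)-\frac14\,R\#\omega.$$
   Context: A $(p,q)$ double form on $M$ is a smooth section of $\Lambda^pT^*M\otimes\Lambda^qT^*M$. Exterior product: $(\theta_1\otimes\theta_2).(\theta_3\otimes\theta_4)=(\theta_1\wedge\theta_3)\otimes(\theta_2\wedge\theta_4)$ (dot often omitted; powers $g^k$ for this product). Composition product: $(\theta_1\otimes\theta_2)\circ(\theta_3\otimes\theta_4)=\langle\theta_1,\theta_4\rangle\,\theta_3\otimes\theta_2$, extended bilinearly. $R$ is the Riemann curvature tensor seen as a symmetric $(2,2)$ double form with $R=\frac12g^2$ on the unit round sphere; $\mathrm{Ric}$ is the Ricci tensor seen as a $(1,1)$ double form. For a 2-form $E$, let $A_E$ be the derivation of $\Lambda T_x^*M$ given by $A_E\theta=\sum_k\iota_{e_k}E\wedge\iota_{e_k}\theta$ ($(e_k)$ orthonormal), and $(\rho(E))_d(\theta_1\otimes\theta_2)=A_E\theta_1\otimes\theta_2+\theta_1\otimes A_E\theta_2$. With $(E_\alpha)$ an orthonormal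 basis of $\Lambda^2T^*_xM$ of eigenvectors of the curvature operator with eigenvalues $\lambda_\alpha$, the Lichnérowicz Laplacian is $$\Delta_L\omega=\nabla^*\nabla\omega-\tfrac12\sum_\alpha\lambda_\alpha(\rho(E_\alpha))_d\circ(\rho(E_\alpha))_d(\omega).$$ (It equals $\frac12(\Delta+\tilde\Delta)$, the average of the left and right Hodge–de Rham Laplacians on double forms.) Sharp product: the Clifford product on $\Lambda V^*$ ($V=T_xM$) is the associative bilinear product determined, for $e\in V^*$, $\alpha\in\Lambda^pV^*$, by $e\cdot\alpha=e\wedge\alpha-\iota_e\alpha$ and $\alpha\cdot e=(-1)^p(e\wedge\alpha+\iota_e\alpha)$. With $[\alpha,\beta]=\alpha\cdot\beta-\beta\cdot\alpha$, $(\alpha_1\otimes\alpha_2)\#(\beta_1\otimes\beta_2)=[\alpha_1,\beta_1]\otimes[\alpha_2,\beta_2]$, extended bilinearly. *)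

(* Defs.v *)
From HB Require Import structures.
From mathcomp Require Import all_boot all_order all_algebra.
From mathcomp Require Import all_classical all_reals all_analysis.
Set Implicit Arguments.
Unset Strict Implicit.
Unset Printing Implicit Defensive.
Import Order.TTheory GRing.Theory Num.Theory.
Import numFieldNormedType.Exports.
Local Open Scope classical_set_scope.
Local Open Scope ring_scope.

(** * Exterior algebra and double forms on R^n *)

(* An element of the exterior algebra is its family of coefficients on
   e_I = e_i1 /\ ... /\ e_ip  (I = {i1 < ... < ip}); a double form is its family
   of coefficients on the e_I (x) e_J. *)
Notation ext R n := {ffun {set 'I_n} -> R^o}.
Notation dbl R n := {ffun {set 'I_n} * {set 'I_n} -> R^o}.

Section Algebra.
Variables (R : realType) (n : nat).
Implicit Types (a b : ext R n) (w v : dbl R n) (i k : 'I_n) (I J : {set 'I_n}).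

Definition ebasis I : ext R n := [ffun J => (J == I)%:R].

Definition one_form i : ext R n := ebasis [set i].

Definition is_pform (p : nat) a := forall I, #|I| != p -> a I = 0.

(* The sign is (-1)^(number of inversions of the concatenation of I and J). *)
Definition wedge_basis I J : ext R n :=
  if [disjoint I & J]
  then (-1) ^+ #|[set ij in finset.setX I J | (ij.2 < ij.1)%N]| *: ebasis (I :|: J)
  else 0.

Definition wedge a b : ext R n :=
  \sum_I \sum_J (a I * b J) *: wedge_basis I J.

(* Interior product with the k-th vector of the basis of R^n dual to (e_i). *)
Definition iota_ k a : ext R n :=
  \sum_(I : {set 'I_n} | k \in I)
     ((-1) ^+ #|[set i in I | (i < k)%N]| * a I) *: ebasis (I :\ k).

(* The exterior power of the substitution e_i |-> \sum_j B i j e_j. *)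
Definition ext_subst (B : 'M[R]_n) a : ext R n :=
  \sum_I a I *:
    \big[wedge/ebasis finset.set0]_(i <- enum I) (\sum_j B i j *: one_form j).

(* In ext_inner, clifford, action2 and the operations built on them, the basis
   (e_i) is orthonormal. *)
Definition ext_inner a b : R := \sum_I a I * b I.

(* As (e_i) is orthonormal, e_I = e_i1 . ... . e_ip for the Clifford product,
   and e . beta = e /\ beta - iota_e beta for a one-form e. *)
Definition clifford a b : ext R n :=
  \sum_I a I *:
    foldr (fun i c => wedge (one_form i) c - iota_ i c) b (enum I).

Definition commutator a b : ext R n := clifford a b - clifford b a.

(* The derivation A_E of the exterior algebra, for a 2-form E. *)
Definition action2 (E : ext R n) a : ext R n :=
  \sum_k wedge (iota_ k E) (iota_ k a).

Definition tens a b : dbl R n := [ffun IJ => a IJ.1 * b IJ.2].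

(* The linear extension of a map given on decomposable elements. *)
Definition dbl_lin (f : ext R n -> ext R n -> dbl R n) w : dbl R n :=
  \sum_I \sum_J w (I, J) *: f (ebasis I) (ebasis J).

Definition dbl_one : dbl R n := tens (ebasis finset.set0) (ebasis finset.set0).

Definition dbl_mul w v : dbl R n :=
  dbl_lin (fun a1 a2 => dbl_lin (fun b1 b2 =>
    tens (wedge a1 b1) (wedge a2 b2)) v) w.

Definition dbl_exp w (k : nat) : dbl R n := iter k (dbl_mul w) dbl_one.

Definition dbl_compose w v : dbl R n :=
  dbl_lin (fun a1 a2 => dbl_lin (fun b1 b2 =>
    ext_inner a1 b2 *: tens b1 a2) v) w.

Definition dbl_sharp w v : dbl R n :=
  dbl_lin (fun a1 a2 => dbl_lin (fun b1 b2 =>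
    tens (commutator a1 b1) (commutator a2 b2)) v) w.

Definition rho_d (E : ext R n) w : dbl R n :=
  dbl_lin (fun a b => tens (action2 E a) b + tens a (action2 E b)) w.

Definition dbl_subst (B : 'M[R]_n) w : dbl R n :=
  dbl_lin (fun a b => tens (ext_subst B a) (ext_subst B b)) w.

(* The operator on 2-forms attached to a (2,2) double form; with it,
   (1/2) g^2 is the identity. *)
Definition curv_op (Rm : dbl R n) (E : ext R n) : ext R n :=
  \sum_I \sum_J (Rm (I, J) * ext_inner (ebasis I) E) *: ebasis J.

Definition curvature_eigenbasis (Rm : dbl R n) (A : finType)
    (E : A -> ext R n) (lam : A -> R) : Prop :=
  [/\ forall al, is_pform 2 (E al),
      forall al be, ext_inner (E al) (E be) = (al == be)%:R,
      forall a, is_pform 2 a -> exists c : A -> R, a = \sum_al c al *: E al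
    & forall al, curv_op Rm (E al) = lam al *: E al].

Definition calN (g Rm Ric : dbl R n) (p : nat) : dbl R n :=
  match p with
  | 0%N => 0
  | 1%N => Ric
  | k.+2 => (k.+1)`!%:R^-1 *: dbl_mul (dbl_exp g k.+1) Ric
            - (2 * k`!%:R^-1) *: dbl_mul (dbl_exp g k) Rm
  end.

End Algebra.

(** * Smooth functions on open subsets of R^n *)

Section Smooth.
Variables (R : realType) (n : nat).
Implicit Types (f : 'rV[R]_n -> R^o) (U : set 'rV[R]_n).

Definition partial (i : 'I_n) f : 'rV[R]_n -> R^o :=
  fun y => 'D_(delta_mx 0 i) f y.

Fixpoint C_k (k : nat) U f : Prop :=
  (forall y, U y -> {for y, continuous f}) /\
  if k is k'.+1 then
    forall i : 'I_n, (forall y, U y -> derivable f y (delta_mx 0 i)) /\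
                     C_k k' U (partial i f)
  else True.

Definition smooth_on U f : Prop := forall k, C_k k U f.

End Smooth.

(** * Riemannian manifolds and double forms on them *)

Record manifold (R : realType) (n : nat) := Manifold {
  space :> topologicalType;
  chart : Type;
  dom : chart -> set space;
  chart_map : chart -> space -> 'rV[R]_n;
  chart_inv : chart -> 'rV[R]_n -> space;
  chart_img : chart -> set 'rV[R]_n := fun c => chart_map c @` dom c;
  _ : hausdorff_space space;
  _ : @second_countable space;
  dom_open : forall c, open (dom c);
  dom_cover : forall x, exists c, dom c x;
  chart_img_open : forall c, open (chart_img c);
  chart_mapK : forall c x, dom c x -> chart_inv c (chart_map c x) = x;
  chart_map_cont : forall c x, dom c x -> {for x, continuous (chart_map c)};
  chart_inv_cont : forall c y, chart_img c y -> {for y, continuous (chart_inv c)};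
  transition_smooth : forall c d (i : 'I_n),
    smooth_on (chart_map c @` (dom c `&` dom d))
              (fun y => chart_map d (chart_inv c y) 0 i)
}.

Section Fields.
Variables (R : realType) (n : nat) (M : manifold R n).

Definition dchart (c : chart M) (k : 'I_n) (f : M -> R) (x : M) : R :=
  partial k (fun y => f (chart_inv c y)) (chart_map c x).

(* d y^i = \sum_j (chart_jacobian c d x) i j d x^j, with x^j the coordinates of c and
   y^i those of d. *)
Definition chart_jacobian (c d : chart M) (x : M) : 'M[R]_n :=
  \matrix_(i, j) dchart c j (fun z => chart_map d z 0 i) x.

(* A double form is given by its components in the coframes d x^i of all the
   charts; only the values at points of the domain of the chart are relevant. *)
Record double_form (p q : nat) := DoubleForm {
  df_comp :> chart M -> M -> dbl R n;
  df_smooth : forall c IJ,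
    smooth_on (chart_img c) (fun y => df_comp c (chart_inv c y) IJ);
  df_degree : forall c x (I J : {set 'I_n}), dom c x ->
    (#|I|, #|J|) != (p, q) -> df_comp c x (I, J) = 0;
  df_change : forall c d x, dom c x -> dom d x ->
    df_comp c x = dbl_subst (chart_jacobian c d x) (df_comp d x)
}.

Definition gram (w : dbl R n) : 'M[R]_n :=
  \matrix_(i, j) w ([set i], [set j])%SET.

Record metric := Metric {
  met :> double_form 1 1;
  met_sym : forall c x, dom c x -> (gram (met c x))^T = gram (met c x);
  met_pos : forall c x (v : 'rV[R]_n), dom c x -> v != 0 ->
    0 < (v *m gram (met c x) *m v^T) 0 0
}.

Variables (g : metric) (c : chart M).

Definition gdn (x : M) : 'M[R]_n := gram (g c x).
Definition gup (x : M) : 'M[R]_n := invmx (gdn x).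

(* christoffel i j k is the component of nabla_i d_j (Levi-Civita) on d_k. *)
Definition christoffel (i j k : 'I_n) (x : M) : R :=
  2^-1 * \sum_l gup x k l *
    (dchart c i (fun z => gdn z j l) x + dchart c j (fun z => gdn z i l) x
     - dchart c l (fun z => gdn z i j) x).

(* nabla_k acts on the coefficients in the coframe by d_k, and on the coframe by
   nabla_k d x^a = - \sum_b christoffel k b a d x^b, extended as a derivation. *)
Definition nabla (k : 'I_n) (T : M -> dbl R n) (x : M) : dbl R n :=
  [ffun IJ => dchart c k (fun z => T z IJ) x]
  - \sum_a \sum_b christoffel k b a x *:
      dbl_lin (fun u v => tens (wedge (one_form R b) (iota_ a u)) v
                     + tens u (wedge (one_form R b) (iota_ a v))) (T x).

Definition nabla2 (k l : 'I_n) (T : M -> dbl R n) (x : M) : dbl R n :=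
  nabla k (nabla l T) x - \sum_m christoffel k l m x *: nabla m T x.

(* nabla^* nabla = - trace_g nabla^2, in the coframe of the chart c. *)
Definition rough_laplacian (T : M -> dbl R n) (x : M) : dbl R n :=
  - \sum_k \sum_l gup x k l *: nabla2 k l T x.

(* R(d_i, d_j) d_k = \sum_l riem_up i j k l d_l, where
   R(X, Y) = [nabla_X, nabla_Y] - nabla_[X, Y]. *)
Definition riem_up (i j k l : 'I_n) (x : M) : R :=
  dchart c i (christoffel j k l) x - dchart c j (christoffel i k l) x
  + \sum_m (christoffel j k m x * christoffel i m l x
            - christoffel i k m x * christoffel j m l x).

(* g(R(d_i, d_j) d_l, d_k): this order of k and l gives (1/2) g^2 on the unit
   sphere. *)
Definition riem_dn (i j k l : 'I_n) (x : M) : R :=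
  \sum_m riem_up i j l m x * gdn x m k.

Definition riemann (x : M) : dbl R n :=
  4^-1 *: \sum_i \sum_j \sum_k \sum_l riem_dn i j k l x *:
    tens (wedge (one_form R i) (one_form R j))
         (wedge (one_form R k) (one_form R l)).

Definition ricci (x : M) : dbl R n :=
  \sum_j \sum_k (\sum_i riem_up i j k i x) *: tens (one_form R j) (one_form R k).

(* The rows of F are the coordinates of the vectors of a basis of T_x M. *)
Definition orthonormal_frame (x : M) (F : 'M[R]_n) : Prop :=
  F *m gdn x *m F^T = 1%:M.

(* From the components in the coframe (d x^i) to the components in the coframe
   (e^a) dual to F: d x^i = \sum_a F a i e^a. *)
Definition in_frame (F : 'M[R]_n) (w : dbl R n) : dbl R n := dbl_subst F^T w.

(* The value at x, in the frame F, of the Lichnerowicz Laplacian of w; the E al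
   are an orthonormal eigenbasis of the curvature operator at x, for the
   eigenvalues lam al, and are also given in the frame F. *)
Definition lichnerowicz (T : M -> dbl R n) (x : M) (F : 'M[R]_n) (A : finType)
    (E : A -> ext R n) (lam : A -> R) : dbl R n :=
  in_frame F (rough_laplacian T x)
  - 2^-1 *: \sum_al lam al *: rho_d (E al) (rho_d (E al) (in_frame F (T x))).

End Fields.

(* Main.v *)
Require Import Defs.
From HB Require Import structures.
From mathcomp Require Import all_boot all_order all_algebra perm.
From mathcomp Require Import all_classical all_reals all_analysis.
From mathcomp Require Import ring lra zify.
Set Implicit Arguments.
Unset Strict Implicit.
Unset Printing Implicit Defensive.
Import Order.TTheory GRing.Theory Num.Theory.
Import numFieldNormedType.Exports.
Local Open Scope ring_scope.

(** The rough Laplacian occurs on both sides of the formula, so what has to be proved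
    is an identity at one point between algebraic operators on double forms, in an
    orthonormal frame.

    Decompose the curvature on the eigenbasis as sum lambda E (x) E
    ([curvature_form_eigen]). Then (rho(E))_d is A_E (x) 1 + 1 (x) A_E, and its square
    is A_E^2 (x) 1 + 1 (x) A_E^2 + 2 A_E (x) A_E. For a 2-form E the Clifford
    commutator with E is 2 A_E ([commutator_2form]), so the cross terms sum to half the
    sharp product with the curvature. It remains to see that - sum lambda A_E^2 acts on
    p-forms as the double form N_p does by composition. With eps and iota the exterior
    and interior products by the vectors of the frame, A_E^2 is bilinear in E, hence
    sum lambda A_E^2 depends only on the curvature tensor r and not on the eigenbasis;
    it equals sum r_ijkl eps_j iota_i eps_l iota_k. Normal ordering of its opposite
    produces the Ricci tensor as a one-body operator and, by the first Bianchi identity, half of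
    sum r_ijkl eps_i eps_j iota_k iota_l as a two-body operator
    ([weitzenbock_forms]). On the other side, g^k / k! is the sum of the e_K (x) e_K over
    the sets K of k indices, and multiplying by it is precisely the passage from a
    (1,1) or (2,2) double form to the one-body or two-body operator on forms of higher
    degree ([act_left_calN]).

    The symmetries of the curvature tensor used here have to be derived from its
    definition by Christoffel symbols. Antisymmetry in the last two indices amounts to
    metric compatibility and to the symmetry of second derivatives of the metric
    coefficients ([derive_commute], [riem_low_antisym]); the Bianchi identity follows
    from the symmetry of the Christoffel symbols ([riem_loc_bianchi]); the pair
    symmetry follows from these and the antisymmetry in the first two indices. Finally
    all the tensors are transported to the orthonormal frame, where the metric becomes the sum of the e_i (x) e_i and the Ricci
    tensor becomes the trace of r. *)

(** * The exterior algebra *)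

Section Exterior.
Import boot.finset.
Variables (R : realType) (n : nat).
Implicit Types (a b u v : ext R n) (w : dbl R n) (i k : 'I_n) (I J K : {set 'I_n}).

(** As a double sum, the inversion number is additive in each argument over
    disjoint unions; all sign identities below come from this additivity. *)
Definition inversions I J : nat := (\sum_(i in I) \sum_(j in J) (j < i)%N)%N.

Definition shuffle_sign I J : R := (-1) ^+ inversions I J.

Lemma card_inversions I J :
  #|[set ij in setX I J | (ij.2 < ij.1)%N]%SET| = inversions I J.
Proof.
rewrite /inversions pair_big_dep /= -sum1_card.
rewrite big_mkcond [RHS]big_mkcond; apply: eq_bigr => -[i j] _ /=.
by rewrite !inE /=; case: (i \in I); case: (j \in J); case: (j < i)%N.
Qed.

Lemma wedge_basisE I J :
  wedge_basis R I J =
  if [disjoint I & J] then shuffle_sign I J *: ebasis R (I :|: J)%SET else 0.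
Proof. by rewrite /wedge_basis card_inversions. Qed.

Lemma disjoint_setU I J K :
  [disjoint (I :|: J)%SET & K] = [disjoint I & K] && [disjoint J & K].
Proof. by rewrite !disjoints_subset finset.subUset. Qed.

Lemma sum_setU (f : 'I_n -> nat) I J : [disjoint I & J] ->
  (\sum_(i in (I :|: J)%SET) f i = \sum_(i in I) f i + \sum_(i in J) f i)%N.
Proof.
move=> dIJ; rewrite -bigU //; apply: eq_bigl => i; by rewrite !inE.
Qed.

Lemma inversionsUl I J K : [disjoint I & J] ->
  inversions (I :|: J)%SET K = (inversions I K + inversions J K)%N.
Proof. by move=> dIJ; rewrite /inversions sum_setU. Qed.

Lemma inversionsUr I J K : [disjoint J & K] ->
  inversions I (J :|: K)%SET = (inversions I J + inversions I K)%N.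
Proof.
move=> dJK; rewrite /inversions -big_split; apply: eq_bigr => i _ /=.
by rewrite sum_setU.
Qed.

Lemma inversions1l k J : inversions [set k]%SET J = #|[set i in J | (i < k)%N]%SET|.
Proof.
rewrite /inversions big_set1 -sum1_card [RHS]big_mkcond [LHS]big_mkcond.
apply: eq_bigr => i _; rewrite !inE.
by case: (i \in J); case: (i < k)%N.
Qed.

Lemma inversionsC I J : [disjoint I & J] ->
  (inversions I J + inversions J I = #|I| * #|J|)%N.
Proof.
move=> dIJ; rewrite /inversions [X in (_ + X)%N]exchange_big -big_split /=.
rewrite -sum1_card big_distrl /=; apply: eq_bigr => i iI.
rewrite -big_split /= mul1n -sum1_card; apply: eq_bigr => j jJ.
have : i != j by apply: contraTneq iI => ->; rewrite (disjointFl dIJ jJ).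
by rewrite -val_eqE /=; case: ltngtP.
Qed.

Lemma ebasisE I J : ebasis R I J = (J == I)%:R.
Proof. by rewrite ffunE. Qed.

Lemma ext_expand a : a = \sum_I a I *: ebasis R I.
Proof.
apply/ffunP => J; rewrite sum_ffunE (bigD1 J) //= big1 => [|I nIJ].
  by rewrite !ffunE eqxx addr0 [_ *: _]mulr1.
by rewrite !ffunE eq_sym (negbTE nIJ) scaler0.
Qed.

Lemma wedge_is_linear a : linear (wedge a).
Proof.
move=> c u v; rewrite /wedge scaler_sumr -big_split; apply: eq_bigr => I _ /=.
rewrite scaler_sumr -big_split; apply: eq_bigr => J _ /=.
by rewrite !ffunE mulrDr scalerDl scalerA /GRing.scale /= mulrCA.
Qed.
HB.instance Definition _ a :=
  GRing.isLinear.Build R (ext R n) (ext R n) _ (wedge a) (wedge_is_linear a).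

Definition wedger b a := wedge a b.
Lemma wedger_is_linear b : linear (wedger b).
Proof.
move=> c u v; rewrite /wedger /wedge scaler_sumr -big_split; apply: eq_bigr => I _ /=.
rewrite scaler_sumr -big_split; apply: eq_bigr => J _ /=.
by rewrite !ffunE mulrDl scalerDl scalerA /GRing.scale /= mulrA.
Qed.
HB.instance Definition _ b :=
  GRing.isLinear.Build R (ext R n) (ext R n) _ (wedger b) (wedger_is_linear b).

Lemma iota_is_linear k : linear (@iota_ R n k).
Proof.
move=> c u v; rewrite /iota_ scaler_sumr -big_split; apply: eq_bigr => I _ /=.
by rewrite !ffunE mulrDr scalerDl scalerA /GRing.scale /= mulrCA.
Qed.
HB.instance Definition _ k :=
  GRing.isLinear.Build R (ext R n) (ext R n) _ (@iota_ R n k) (iota_is_linear k).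

(** Identities between linear operators are proved on the basis vectors. Stating
    them as equalities of composed linear maps avoids expanding the products,
    which are themselves sums over all subsets. *)
Lemma linear_ext_eq (V : lmodType R) (f g : {linear ext R n -> V}) :
  (forall I, f (ebasis R I) = g (ebasis R I)) -> f =1 g.
Proof.
move=> fg a; rewrite (ext_expand a) !linear_sum; apply: eq_bigr => I _.
by rewrite !linearZ /= fg.
Qed.

Lemma wedge_ebasis I J : wedge (ebasis R I) (ebasis R J) = wedge_basis R I J.
Proof.
rewrite /wedge (bigD1 I) //= [X in _ + X]big1 => [|I' nI]; last first.
  by apply: big1 => J' _; rewrite !ffunE (negbTE nI) mul0r scale0r.
rewrite (bigD1 J) //= [X in _ + X + _]big1 => [|J' nJ]; last first.
  by rewrite !ffunE (negbTE nJ) mulr0 scale0r.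
by rewrite !ffunE !eqxx mulr1 scale1r !addr0.
Qed.

(** Both sides count the inversions of I, J and K pairwise. *)
Lemma wedge_basisA I J K :
  wedge (ebasis R I) (wedge (ebasis R J) (ebasis R K)) =
  wedge (wedge (ebasis R I) (ebasis R J)) (ebasis R K).
Proof.
rewrite !wedge_ebasis !wedge_basisE.
have [dJK|ndJK] := boolP [disjoint J & K]; last first.
  rewrite linear0; case: ifP => dIJ; last by rewrite -/(wedger _ 0) linear0.
  rewrite -/(wedger _ _) linearZ /= /wedger wedge_ebasis wedge_basisE.
  by rewrite disjoint_setU (negbTE ndJK) andbF scaler0.
rewrite linearZ /= wedge_ebasis wedge_basisE disjoint_sym disjoint_setU.
rewrite ![[disjoint _ & I]]disjoint_sym.
have [dIJ|ndIJ] := boolP [disjoint I & J]; last first.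
  by rewrite /= scaler0 -/(wedger _ 0) linear0.
rewrite -/(wedger _ _) linearZ /= /wedger wedge_ebasis wedge_basisE disjoint_setU dJK andbT /=.
case: ifP => dIK; last by rewrite !scaler0.
rewrite !scalerA /shuffle_sign -!exprD inversionsUl // inversionsUr // setUA.
by congr (_ ^+ _ *: _); lia.
Qed.

Lemma wedge_suml (T : finType) (P : pred T) (f : T -> ext R n) b :
  wedge (\sum_(t | P t) f t) b = \sum_(t | P t) wedge (f t) b.
Proof. exact: (linear_sum (wedger b)). Qed.

Lemma wedgeZl c a b : wedge (c *: a) b = c *: wedge a b.
Proof. exact: (linearZ_LR (wedger b)). Qed.

Lemma wedgeA a b u : wedge a (wedge b u) = wedge (wedge a b) u.
Proof.
move: u; apply: (@linear_ext_eq _ (wedge a \o wedge b) (wedge (wedge a b))) => K /=.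
move: b; apply: (@linear_ext_eq _ (wedge a \o wedger (ebasis R K))
  (wedger (ebasis R K) \o wedge a)) => J /=.
move: a; apply: (@linear_ext_eq _ (wedger (wedge (ebasis R J) (ebasis R K)))
  (wedger (ebasis R K) \o wedger (ebasis R J))) => I /=.
exact: wedge_basisA.
Qed.

Lemma wedge_basisC I J :
  wedge (ebasis R I) (ebasis R J) =
  (-1) ^+ (#|I| * #|J|) *: wedge (ebasis R J) (ebasis R I).
Proof.
rewrite !wedge_ebasis !wedge_basisE disjoint_sym; case: ifP => d; last by rewrite scaler0.
rewrite scalerA setUC; congr (_ *: _).
rewrite mulnC -(inversionsC d) exprD mulrAC -expr2 sqrr_sign mul1r //.
Qed.

Definition eps k a : ext R n := wedge (one_form R k) a.
HB.instance Definition _ k :=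
  GRing.isLinear.Build R (ext R n) (ext R n) _ (eps k) (wedge_is_linear (one_form R k)).

Lemma eps_ebasis k I : eps k (ebasis R I) =
  if k \in I then 0 else shuffle_sign [set k]%SET I *: ebasis R (k |: I)%SET.
Proof. by rewrite /eps wedge_ebasis wedge_basisE disjoints1; case: (k \in I). Qed.

(** The pair (k, k) is not an inversion, so removing k does not change the sign. *)
Lemma shuffle_sign_set1 k I :
  shuffle_sign [set k]%SET (I :\ k)%SET = shuffle_sign [set k]%SET I.
Proof.
have [kI|kI] := boolP (k \in I); last first.
  by congr shuffle_sign; apply/setP => i; rewrite !inE; case: eqP => // ->; rewrite (negbTE kI).
rewrite -[in RHS](setD1K kI) /shuffle_sign inversionsUr ?disjoints1 ?inE ?eqxx //.
by congr (_ ^+ _); rewrite /inversions !big_set1 ltnn.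
Qed.

(** The sign in the definition of the interior product is that of moving k to the
    front, the same as the one in [epsE]: this is why the two operators are
    adjoint. *)
Lemma iotaE k a I : iota_ k a I =
  if k \in I then 0 else shuffle_sign [set k]%SET I * a (k |: I)%SET.
Proof.
rewrite /iota_ sum_ffunE; case: ifP => kI.
  apply: big1 => J kJ; rewrite !ffunE; case: eqP => [E|_]; rewrite ?scaler0 //.
  by move: kI; rewrite E !inE eqxx.
rewrite (bigD1 (k |: I)%SET) ?setU11 //= big1 => [|J /andP[kJ nJ]].
  rewrite !ffunE setU1K ?kI // eqxx addr0 [LHS]mulr1 -inversions1l.
  by rewrite -/(shuffle_sign _ _) -shuffle_sign_set1 setU1K ?kI.
rewrite !ffunE; case: eqP => [E|_]; rewrite ?scaler0 //.
by move: nJ; rewrite E setD1K ?eqxx.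
Qed.

Lemma epsE k a I : eps k a I =
  if k \in I then shuffle_sign [set k]%SET I * a (I :\ k)%SET else 0.
Proof.
rewrite {1}(ext_expand a) linear_sum sum_ffunE.
have E J : (eps k (a J *: ebasis R J)) I =
    if k \in J then 0 else a J * (shuffle_sign [set k]%SET J * (I == k |: J)%SET%:R).
  rewrite linearZ /= eps_ebasis !ffunE; case: ifP => _; rewrite ?ffunE ?scaler0 //.
rewrite (eq_bigr _ (fun J _ => E J)); case: ifP => kI.
  rewrite (bigD1 (I :\ k)%SET) //= big1 => [|J nJ].
    by rewrite !inE eqxx setD1K // eqxx addr0 mulr1 mulrC shuffle_sign_set1.
  case: ifP => // kJ; case: eqP => [E'|_]; rewrite ?mulr0 //.
  by move: nJ; rewrite E' setU1K ?kJ // eqxx.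
apply: big1 => J _; case: ifP => // kJ; case: eqP => [E'|_]; rewrite ?mulr0 //.
by move: kI; rewrite E' !inE eqxx.
Qed.

Lemma ext_inner_eps k a b : ext_inner (eps k a) b = ext_inner a (iota_ k b).
Proof.
rewrite /ext_inner (bigID (fun I : {set 'I_n} => k \in I)) /= [X in _ + X]big1 ?addr0; last first.
  by move=> I kI; rewrite epsE (negbTE kI) mul0r.
rewrite [RHS](bigID (fun I : {set 'I_n} => k \notin I)) /= [X in _ = _ + X]big1 ?addr0; last first.
  by move=> I; rewrite negbK => kI; rewrite iotaE kI mulr0.
rewrite (reindex_onto (fun I => k |: I)%SET (fun I => I :\ k)%SET) /=; last first.
  by move=> I kI; rewrite setD1K.
rewrite (eq_bigl (fun I : {set 'I_n} => k \notin I)).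
  apply: eq_bigr => I kI; rewrite epsE iotaE setU11 (negbTE kI) setU1K //.
  by rewrite -shuffle_sign_set1 setU1K // mulrCA mulrA.
move=> I; rewrite setU11 /=; apply/eqP/idP => [<-|kI]; last by rewrite setU1K.
by rewrite !inE eqxx.
Qed.

End Exterior.

(** * Creation and annihilation operators, Clifford commutators *)

Section Operators.
Import boot.finset.
Variables (R : realType) (n : nat).
Implicit Types (a b u v : ext R n) (w : dbl R n) (i j k l : 'I_n) (I J K : {set 'I_n}).

Notation one := (ebasis R (set0 : {set 'I_n})).

Lemma linear_pform_eq (V : lmodType R) (f g : {linear ext R n -> V}) p a :
  is_pform p a -> (forall I, #|I| = p -> f (ebasis R I) = g (ebasis R I)) -> f a = g a.
Proof.
move=> ha fg; rewrite (ext_expand a) !linear_sum; apply: eq_bigr => I _.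
have [E|E] := eqVneq #|I| p; first by rewrite !linearZ /= fg.
by rewrite ha // scale0r !linear0.
Qed.

Lemma shuffle_sign_swap i j : i != j ->
  shuffle_sign R [set i] [set j] = - shuffle_sign R [set j] [set i].
Proof.
rewrite -val_eqE /shuffle_sign /inversions !big_set1 /=.
by case: ltngtP => //; rewrite expr0 expr1 ?opprK.
Qed.

Lemma shuffle_signU1 i j I : j \notin I ->
  shuffle_sign R [set i] (j |: I) = shuffle_sign R [set i] [set j] * shuffle_sign R [set i] I.
Proof. by move=> jI; rewrite /shuffle_sign inversionsUr ?disjoints1 // exprD. Qed.

Lemma shuffle_sign_sq I J : shuffle_sign R I J * shuffle_sign R I J = 1.
Proof. by rewrite /shuffle_sign -expr2 sqrr_sign. Qed.

(** The canonical anticommutation relation. For distinct indices the two products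
    of signs differ by the order of i and j, which is a single inversion. *)
Lemma iota_eps i j u : iota_ i (eps j u) = (i == j)%:R *: u - eps j (iota_ i u).
Proof.
apply/eqP; rewrite eq_sym subr_eq; apply/eqP/ffunP => I.
rewrite !ffunE !iotaE !epsE !iotaE.
case: (eqVneq i j) => [<-|ij].
  rewrite setU11 setD11 scale1r; case: ifP => iI.
    by rewrite add0r setD1K // shuffle_sign_set1 mulrA shuffle_sign_sq mul1r.
  by rewrite setU1K ?iI // -(shuffle_sign_set1 _ i (i |: I)) setU1K ?iI // mulrA shuffle_sign_sq mul1r addr0.
rewrite scale0r !inE (eq_sym j i) (negbTE ij) /=.
case: ifP => iI; case: ifP => jI; rewrite ?mulr0 ?addr0 //.
have E : ((i |: I) :\ j = i |: I :\ j)%SET.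
  by apply/setP => k; rewrite !inE; case: (eqVneq k i) => [->|]; rewrite ?ij ?orbF.
rewrite E !mulrA -mulrDl.
have -> : shuffle_sign R [set i] I =
    shuffle_sign R [set i] [set j] * shuffle_sign R [set i] (I :\ j).
  by rewrite -shuffle_signU1 ?setD11 // setD1K.
have -> : shuffle_sign R [set j] (i |: I) =
    shuffle_sign R [set j] [set i] * shuffle_sign R [set j] I.
  by rewrite -shuffle_signU1 ?iI.
rewrite (shuffle_sign_swap ij).
by ring: (shuffle_sign_sq [set j] [set i]).
Qed.

Lemma ext_innerE I a : ext_inner (ebasis R I) a = a I.
Proof.
rewrite /ext_inner (bigD1 I) //= big1 => [|J nJ]; rewrite ebasisE.
  by rewrite eqxx mul1r addr0.
by rewrite (negbTE nJ) mul0r.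
Qed.

Lemma one_formE i : one_form R i = eps i one.
Proof.
by rewrite eps_ebasis inE setU0 /shuffle_sign /inversions big_set1 big_set0 expr0 scale1r. Qed.

Lemma eps_anti i j u : eps i (eps j u) = - eps j (eps i u).
Proof.
rewrite /eps !wedgeA /one_form wedge_basisC !cards1 expr1 wedgeZl scaleN1r //.
Qed.

Lemma eps_twice i u : eps i (eps i u) = 0.
Proof.
apply/eqP; have /eqP := eps_anti i i u.
by rewrite -subr_eq0 opprK -mulr2n -scaler_nat scaler_eq0 pnatr_eq0.
Qed.

Lemma ext_inner_is_linear a : linear (ext_inner a : ext R n -> R^o).
Proof.
move=> c u v; rewrite /ext_inner scaler_sumr -big_split; apply: eq_bigr => I _ /=.
by rewrite !ffunE mulrDr /GRing.scale /= mulrCA.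
Qed.
HB.instance Definition _ a :=
  GRing.isLinear.Build R (ext R n) R^o _ (ext_inner a) (ext_inner_is_linear a).

Lemma iota_anti i j u : iota_ i (iota_ j u) = - iota_ j (iota_ i u).
Proof.
apply/ffunP => I; rewrite -!ext_innerE linearN /= -!ext_inner_eps eps_anti.
transitivity (- ext_inner (eps i (eps j (ebasis R I))) u); last by rewrite !ext_inner_eps.
rewrite /ext_inner -[RHS]sumrN; apply: eq_bigr => J _.
by rewrite ffunE mulNr.
Qed.

Lemma iota_one i : iota_ i one = 0.
Proof.
apply/ffunP => I; rewrite iotaE !ffunE; case: ifP => // _.
by case: eqP => [E|]; rewrite ?mulr0 //; have := setU11 i I; rewrite E inE.
Qed.

Lemma action2_is_linear a : linear (action2 a).
Proof.
move=> c u v; rewrite /action2 scaler_sumr -big_split; apply: eq_bigr => k _ /=.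
by rewrite !linearP.
Qed.
HB.instance Definition _ a :=
  GRing.isLinear.Build R (ext R n) (ext R n) _ (action2 a) (action2_is_linear a).

Definition action2r u a := action2 a u.
Lemma action2r_is_linear u : linear (action2r u).
Proof.
move=> c a b; rewrite /action2r /action2 scaler_sumr -big_split; apply: eq_bigr => k _ /=.
by rewrite !linearP -/(wedger _ _) linearP.
Qed.
HB.instance Definition _ u :=
  GRing.isLinear.Build R (ext R n) (ext R n) _ (action2r u) (action2r_is_linear u).

(** The derivation of a decomposable 2-form is the corresponding infinitesimal
    rotation. *)
Lemma action2_wedge i j u :
  action2 (wedge (one_form R i) (one_form R j)) u = eps j (iota_ i u) - eps i (iota_ j u).
Proof.
have E k : iota_ k (wedge (one_form R i) (one_form R j))
         = (k == i)%:R *: one_form R j - (k == j)%:R *: one_form R i.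
  rewrite -/(eps i _) (one_formE j) !iota_eps iota_one !linear0 addr0.
  by rewrite linearZ /= -!one_formE.
rewrite /action2 (eq_bigr (fun k => (k == i)%:R *: eps j (iota_ k u)
    + (k == j)%:R *: (- eps i (iota_ k u)))); last first.
  move=> k _; rewrite E -/(wedger _ _) linearB /= /wedger !wedgeZl scalerN //.
rewrite big_split; congr (_ + _).
  rewrite (bigD1 i) //= big1 ?eqxx ?scale1r ?addr0 // => k /negbTE->; exact: scale0r.
rewrite (bigD1 j) //= big1 ?eqxx ?scale1r ?addr0 // => k /negbTE->; exact: scale0r.
Qed.

Definition cliff_lmul i u := eps i u - iota_ i u.
Lemma cliff_lmul_is_linear i : linear (cliff_lmul i).
Proof.
move=> c u v; rewrite /cliff_lmul !linearP /=.
by apply/ffunP => I; rewrite !ffunE /GRing.scale /=; ring.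
Qed.
HB.instance Definition _ i :=
  GRing.isLinear.Build R (ext R n) (ext R n) _ (cliff_lmul i) (cliff_lmul_is_linear i).

Lemma cliffordE a b : clifford a b = \sum_I a I *: foldr cliff_lmul b (enum I).
Proof. by []. Qed.

(** The grading involution turns the sign (-1)^p of the right Clifford product by a
    one-form into a linear operator. *)
Definition parity u : ext R n := [ffun I : {set 'I_n} => (-1) ^+ #|I| * u I].
Lemma parity_is_linear : linear parity.
Proof.
by move=> c u v; apply/ffunP => I; rewrite !ffunE mulrDr /GRing.scale /= mulrCA.
Qed.
HB.instance Definition _ :=
  GRing.isLinear.Build R (ext R n) (ext R n) _ parity parity_is_linear.

Lemma epsD i u v : eps i (u + v) = eps i u + eps i v. Proof. exact: linearD. Qed.
Lemma epsN i u : eps i (- u) = - eps i u. Proof. exact: linearN. Qed.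
Lemma iotaD i u v : iota_ i (u + v) = iota_ i u + iota_ i v. Proof. exact: linearD. Qed.
Lemma iotaN i u : iota_ i (- u) = - iota_ i u. Proof. exact: linearN. Qed.
Lemma parityD u v : parity (u + v) = parity u + parity v. Proof. exact: linearD. Qed.
Lemma parityN u : parity (- u) = - parity u. Proof. exact: linearN. Qed.
Definition operator_linearE := (epsD, epsN, iotaD, iotaN, parityD, parityN).

Lemma parityK : involutive parity.
Proof. by move=> u; apply/ffunP => I; rewrite !ffunE mulrA -expr2 sqrr_sign mul1r. Qed.

Lemma parity_eps i u : parity (eps i u) = - eps i (parity u).
Proof.
apply/ffunP => I; rewrite !ffunE !epsE !ffunE; case: ifP => iI; last by rewrite mulr0 oppr0.
by rewrite (cardsD1 i I) iI exprS; ring.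
Qed.

Lemma parity_iota i u : parity (iota_ i u) = - iota_ i (parity u).
Proof.
apply/ffunP => I; rewrite !ffunE !iotaE !ffunE; case: ifP => iI; first by rewrite mulr0 oppr0.
by rewrite cardsU1 iI exprS; ring.
Qed.

Definition cliff_rmul i u := eps i (parity u) + iota_ i (parity u).
Lemma cliff_rmul_is_linear i : linear (cliff_rmul i).
Proof.
move=> c u v; rewrite /cliff_rmul !linearP /=.
by apply/ffunP => I; rewrite !ffunE /GRing.scale /=; ring.
Qed.
HB.instance Definition _ i :=
  GRing.isLinear.Build R (ext R n) (ext R n) _ (cliff_rmul i) (cliff_rmul_is_linear i).

(** Left and right Clifford multiplications commute, because e /\ - iota and
    e /\ + iota anticommute and the grading involution anticommutes with both.
    This form of associativity is all that commutators with 2-forms use. *)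
Lemma cliff_lmul_rmul i j u : cliff_lmul i (cliff_rmul j u) = cliff_rmul j (cliff_lmul i u).
Proof.
rewrite /cliff_lmul /cliff_rmul !operator_linearE parity_eps parity_iota !operator_linearE !iota_eps.
rewrite (eps_anti i j) (iota_anti i j) (eq_sym i j).
by apply/ffunP => I; rewrite !ffunE; ring.
Qed.

(** Each new index is smaller than the previous ones: the contraction vanishes and
    the wedge product has no inversion. *)
Lemma cliff_lmul_sorted (s : seq 'I_n) :
  sorted ltn (map val s) -> foldr cliff_lmul one s = ebasis R [set i in s].
Proof.
elim: s => [|i s IH] /=; first by rewrite set_nil.
move=> ps; rewrite IH ?(path_sorted ps) //.
have is_ j : j \in s -> (i < j)%N.
  move: ps; rewrite (path_sortedE ltn_trans) => /andP[/allP h _] js.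
  by apply: h; exact: map_f.
have nis : i \notin s by apply/negP => /is_; rewrite ltnn.
rewrite /cliff_lmul eps_ebasis inE (negbTE nis) set_cons.
have -> : iota_ i (ebasis R [set j in s]) = 0.
  apply/ffunP => I; rewrite iotaE !ffunE; case: ifP => // _.
  case: eqP => [E|]; rewrite ?mulr0 //; have := setU11 i I.
  by rewrite E inE (negbTE nis).
rewrite subr0 /shuffle_sign; suff -> : inversions [set i] [set j in s] = 0%N by rewrite expr0 scale1r.
rewrite /inversions big_set1 big1 // => j; rewrite inE => /is_.
by case: ltngtP.
Qed.

Lemma sorted_enum_set I : sorted ltn (map val (enum I)).
Proof.
rewrite sorted_map /enum_mem; apply: sorted_filter; first by move=> j i k; exact: ltn_trans.
by rewrite -enumT -sorted_map val_enum_ord iota_ltn_sorted.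
Qed.

Lemma cliff_lmul_enum I : foldr cliff_lmul one (enum I) = ebasis R I.
Proof.
rewrite cliff_lmul_sorted ?sorted_enum_set //.
by congr ebasis; apply/setP => i; rewrite inE mem_enum.
Qed.

Lemma clifford_one a : clifford a one = a.
Proof. rewrite cliffordE [RHS]ext_expand; apply: eq_bigr => I _; by rewrite cliff_lmul_enum. Qed.

Lemma clifford_cliff_rmul a i u : clifford a (cliff_rmul i u) = cliff_rmul i (clifford a u).
Proof.
rewrite !cliffordE linear_sum; apply: eq_bigr => I _; rewrite linearZ /=; congr (_ *: _).
by elim: (enum I) => //= j s ->; rewrite cliff_lmul_rmul.
Qed.

Lemma clifford_basis I b : clifford (ebasis R I) b = foldr cliff_lmul b (enum I).
Proof.
rewrite cliffordE (bigD1 I) //= big1 ?ebasisE ?eqxx ?scale1r ?addr0 // => J nJ.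
by rewrite ebasisE (negbTE nJ) scale0r.
Qed.

Lemma commutator_is_linear b : linear ((@commutator R n)^~ b).
Proof.
move=> c u v.
have lin_r a : linear (clifford a).
  move=> c' u' v'; rewrite !cliffordE scaler_sumr -big_split; apply: eq_bigr => I _ /=.
  rewrite scalerA mulrC -scalerA -scalerDr; congr (_ *: _).
  by elim: (enum I) => //= i s ->; rewrite linearP.
rewrite /commutator lin_r.
have -> : clifford (c *: u + v) b = c *: clifford u b + clifford v b.
  rewrite !cliffordE scaler_sumr -big_split; apply: eq_bigr => I _ /=.
  by rewrite !ffunE scalerDl scalerA.
by rewrite scalerBr opprD addrACA.
Qed.

(** The commutator with e /\ e' is (e - iota)(e' - iota') - (e + iota)(e' + iota'):
    the terms that change the degree by two cancel and the mixed ones double. *)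
Lemma commutator_2basis I b : #|I| = 2 ->
  commutator (ebasis R I) b = 2 *: action2 (ebasis R I) b.
Proof.
rewrite cardE => sI.
have [i [j E]] : exists i j, enum I = [:: i; j].
  by move: sI; case: (enum I) => [|i [|j []]] // _; exists i, j.
have ij : i != j by have := enum_uniq I; rewrite E /= inE andbT.
have EI : ebasis R I = eps i (eps j one).
  rewrite -cliff_lmul_enum E /= /cliff_lmul iota_one subr0 iota_eps (negbTE ij) scale0r iota_one.
  by rewrite !(linear0, addr0).
have -> : action2 (ebasis R I) b = eps j (iota_ i b) - eps i (iota_ j b).
  by rewrite EI -action2_wedge -one_formE.
rewrite /commutator clifford_basis E /=.
have -> : clifford b (ebasis R I) = cliff_rmul j (cliff_rmul i b).
  rewrite -{2}(clifford_one b) -!clifford_cliff_rmul; congr clifford; rewrite EI /cliff_rmul.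
  have p1 : parity one = one.
    apply/ffunP => J; rewrite !ffunE; case: eqP => [->|_]; rewrite ?mulr0 //.
    by rewrite cards0 expr0 mul1r.
  rewrite p1 iota_one addr0 parity_eps p1 !operator_linearE iota_eps iota_one.
  by rewrite (eq_sym j) (negbTE ij) scale0r !(linear0, addr0) eps_anti.
rewrite /cliff_rmul /cliff_lmul !operator_linearE !(parity_eps, parity_iota).
rewrite !operator_linearE !parityK !iota_eps.
rewrite (eq_sym j) (negbTE ij) !scale0r (eps_anti j i) (iota_anti j i).
by apply/ffunP => J; rewrite !ffunE /GRing.scale /=; ring.
Qed.

Lemma commutator_2form a b : is_pform 2 a -> commutator a b = 2 *: action2 a b.
Proof.
move=> ha.
pose f := fun a => commutator a b.
pose F : {linear ext R n -> ext R n} := HB.pack f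
  (GRing.isLinear.Build R (ext R n) (ext R n) _ f (commutator_is_linear b)).
apply: (linear_pform_eq (f := F) (g := GRing.scale 2 \o action2r b) ha) => I hI.
exact: commutator_2basis.
Qed.

End Operators.

(** * Double forms as bilinear data *)

Section DoubleForms.
Import boot.finset.
Variables (R : realType) (n : nat).
Implicit Types (a b u v : ext R n) (w x y : dbl R n) (i j k l : 'I_n) (I J K : {set 'I_n}).

Notation one := (ebasis R (set0 : {set 'I_n})).

(** [dbl_lin] with values in any module: contractions of double forms take values in
    the exterior algebra, not in the double forms. *)
Definition dbl_ext (V : lmodType R) (f : ext R n -> ext R n -> V) w : V :=
  \sum_I \sum_J w (I, J) *: f (ebasis R I) (ebasis R J).

Lemma dbl_ext_is_linear (V : lmodType R) f : linear (@dbl_ext V f).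
Proof.
move=> c x y; rewrite /dbl_ext scaler_sumr -big_split; apply: eq_bigr => I _ /=.
rewrite scaler_sumr -big_split; apply: eq_bigr => J _ /=.
by rewrite !ffunE scalerDl scalerA.
Qed.
HB.instance Definition _ (V : lmodType R) f :=
  GRing.isLinear.Build R (dbl R n) V _ (@dbl_ext V f) (dbl_ext_is_linear f).

Lemma dbl_linE f w : dbl_lin f w = dbl_ext f w. Proof. by []. Qed.

Lemma sum_ext_basis (V : lmodType R) (f : ext R n -> V) : linear f ->
  forall a, \sum_I a I *: f (ebasis R I) = f a.
Proof.
move=> lf a; pose F : {linear ext R n -> V} := HB.pack f
  (GRing.isLinear.Build R (ext R n) V _ f lf).
rewrite -[f in LHS]/(F : _ -> _) -[RHS]/(F a) {2}(ext_expand a) linear_sum.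
by apply: eq_bigr => I _; rewrite linearZ.
Qed.

Lemma dbl_ext_tens (V : lmodType R) (f : ext R n -> ext R n -> V) a b :
  (forall v, linear (f^~ v)) -> (forall u, linear (f u)) ->
  dbl_ext f (tens a b) = f a b.
Proof.
move=> fl fr; rewrite -(sum_ext_basis (fl b) a); apply: eq_bigr => I _ /=.
rewrite -(sum_ext_basis (fr _) b) scaler_sumr; apply: eq_bigr => J _.
by rewrite ffunE scalerA.
Qed.

Lemma tens_linl b : linear ((@tens R n)^~ b).
Proof. by move=> c u v; apply/ffunP => IJ; rewrite !ffunE /GRing.scale /=; ring. Qed.

Lemma tens_linr a : linear (@tens R n a).
Proof. by move=> c u v; apply/ffunP => IJ; rewrite !ffunE /GRing.scale /=; ring. Qed.
HB.instance Definition _ a :=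
  GRing.isLinear.Build R (ext R n) (dbl R n) _ (tens a) (tens_linr a).
Definition tensr b a := tens a b.
HB.instance Definition _ b :=
  GRing.isLinear.Build R (ext R n) (dbl R n) _ (tensr b) (tens_linl b).

Lemma tensZl c a b : tens (c *: a) b = c *: tens a b.
Proof. exact: (linearZ_LR (tensr b)). Qed.
Lemma tens_suml (T : finType) (P : pred T) (f : T -> ext R n) b :
  tens (\sum_(t | P t) f t) b = \sum_(t | P t) tens (f t) b.
Proof. exact: (linear_sum (tensr b)). Qed.
Lemma tensZr c a b : tens a (c *: b) = c *: tens a b.
Proof. exact: (linearZ_LR (tens a)). Qed.
Lemma tens_sumr (T : finType) (P : pred T) (f : T -> ext R n) a :
  tens a (\sum_(t | P t) f t) = \sum_(t | P t) tens a (f t).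
Proof. exact: (linear_sum (tens a)). Qed.

Lemma linear_dbl_ext (V V' : lmodType R) (h : {linear V -> V'}) f w :
  h (dbl_ext f w) = dbl_ext (fun a b => h (f a b)) w.
Proof.
rewrite /dbl_ext linear_sum; apply: eq_bigr => I _; rewrite linear_sum.
by apply: eq_bigr => J _; rewrite linearZ.
Qed.

Lemma exchange_dbl_ext (V : lmodType R) (f : ext R n -> ext R n -> ext R n -> ext R n -> V) x y :
  dbl_ext (fun a1 a2 => dbl_ext (fun b1 b2 => f a1 a2 b1 b2) y) x =
  dbl_ext (fun b1 b2 => dbl_ext (fun a1 a2 => f a1 a2 b1 b2) x) y.
Proof.
have E (f' : ext R n -> ext R n -> V) w : dbl_ext f' w = \sum_p w p *: f' (ebasis R p.1) (ebasis R p.2).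
  by rewrite /dbl_ext pair_big /=; apply: eq_bigr => -[I J] _.
rewrite !E (eq_bigr _ (fun p _ => congr1 _ (E _ _))) [RHS](eq_bigr _ (fun p _ => congr1 _ (E _ _))).
under eq_bigr do rewrite scaler_sumr.
rewrite exchange_big; apply: eq_bigr => p _; rewrite scaler_sumr; apply: eq_bigr => q _.
by rewrite !scalerA mulrC.
Qed.

Definition bidegree (p q : nat) w := forall I J, (#|I|, #|J|) != (p, q) -> w (I, J) = 0.

Lemma eq_dbl_ext (V : lmodType R) (f f' : ext R n -> ext R n -> V) p q w :
  bidegree p q w ->
  (forall I J, #|I| = p -> #|J| = q ->
     f (ebasis R I) (ebasis R J) = f' (ebasis R I) (ebasis R J)) ->
  dbl_ext f w = dbl_ext f' w.
Proof.
move=> dw ff; apply: eq_bigr => I _; apply: eq_bigr => J _.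
have [[E1 E2]|E] := eqVneq (#|I|, #|J|) (p, q); first by rewrite ff.
by rewrite dw // !scale0r.
Qed.

Lemma dbl_mul_linl y : linear ((@dbl_mul R n)^~ y).
Proof. exact: dbl_ext_is_linear. Qed.

Lemma dbl_mul_linr x : linear (dbl_mul x).
Proof.
move=> c u v; rewrite /dbl_mul !dbl_linE.
rewrite /dbl_ext scaler_sumr -big_split; apply: eq_bigr => I _ /=.
rewrite scaler_sumr -big_split; apply: eq_bigr => J _ /=.
rewrite [dbl_lin _ (_ + _)]dbl_ext_is_linear scalerDr; congr (_ + _).
by rewrite !scalerA mulrC.
Qed.
HB.instance Definition _ x :=
  GRing.isLinear.Build R (dbl R n) (dbl R n) _ (dbl_mul x) (dbl_mul_linr x).
Definition dbl_mulr y x := dbl_mul x y.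
HB.instance Definition _ y :=
  GRing.isLinear.Build R (dbl R n) (dbl R n) _ (dbl_mulr y) (dbl_mul_linl y).

Lemma dbl_mul_suml (T : finType) (P : pred T) (f : T -> dbl R n) y :
  dbl_mul (\sum_(t | P t) f t) y = \sum_(t | P t) dbl_mul (f t) y.
Proof. exact: (linear_sum (dbl_mulr y)). Qed.

Lemma dbl_mulZl c x y : dbl_mul (c *: x) y = c *: dbl_mul x y.
Proof. exact: (linearZ_LR (dbl_mulr y)). Qed.

Lemma wedge_linl b : linear ((@wedge R n)^~ b). Proof. exact: (wedger_is_linear b). Qed.

Lemma dbl_mul_tens a b u v : dbl_mul (tens a b) (tens u v) = tens (wedge a u) (wedge b v).
Proof.
have E a' b' : dbl_lin (fun b1 b2 => tens (wedge a' b1) (wedge b' b2)) (tens u v)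
    = tens (wedge a' u) (wedge b' v).
  rewrite dbl_linE dbl_ext_tens // => u' c x y.
    by rewrite wedge_is_linear tens_linl.
  by rewrite wedge_is_linear tens_linr.
transitivity (dbl_ext (fun a1 a2 => tens (wedge a1 u) (wedge a2 v)) (tens a b)).
  by apply: eq_bigr => I _; apply: eq_bigr => J _; rewrite E.
rewrite dbl_ext_tens // => u' c x y.
  by rewrite wedge_linl tens_linl.
by rewrite wedge_linl tens_linr.
Qed.

(** The two contractions through which a double form acts on forms: composing on
    the right with it applies [act_left] to the left factor, composing on the left
    applies [act_right] to the right factor. *)
Definition act_left u w : ext R n := dbl_ext (fun a b => ext_inner b u *: a) w.
Definition act_right u w : ext R n := dbl_ext (fun a b => ext_inner a u *: b) w.

HB.instance Definition _ u :=
  GRing.isLinear.Build R (dbl R n) (ext R n) _ (act_left u) (dbl_ext_is_linear _).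
HB.instance Definition _ u :=
  GRing.isLinear.Build R (dbl R n) (ext R n) _ (act_right u) (dbl_ext_is_linear _).

HB.instance Definition _ f :=
  GRing.isLinear.Build R (dbl R n) (dbl R n) _ (dbl_lin f) (dbl_ext_is_linear f).

Lemma dbl_compose_act_left w x :
  dbl_compose w x = dbl_ext (fun a b => tens (act_left a x) b) w.
Proof.
apply: eq_bigr => I _; apply: eq_bigr => J _; congr (_ *: _).
rewrite -[RHS]/(tensr _ _) /act_left linear_dbl_ext; apply: eq_bigr => K _; apply: eq_bigr => L _.
congr (_ *: _); rewrite /= /tensr tensZl; congr (_ *: _).
by apply: eq_bigr => M _; rewrite mulrC.
Qed.

Lemma dbl_compose_act_right w x :
  dbl_compose x w = dbl_ext (fun a b => tens a (act_right b x)) w.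
Proof.
transitivity (dbl_ext (fun b1 b2 => dbl_ext (fun a1 a2 => ext_inner a1 b2 *: tens b1 a2) x) w).
  exact: exchange_dbl_ext.
apply: eq_bigr => I _; apply: eq_bigr => J _; congr (_ *: _).
rewrite /act_right linear_dbl_ext; apply: eq_bigr => K _; apply: eq_bigr => L _.
by congr (_ *: _); rewrite /= tensZr.
Qed.

(** Exchanging the two expansions makes the curvature the innermost argument, where
    its decomposition on an eigenbasis can be substituted. *)
Lemma dbl_sharp_swap w x :
  dbl_sharp x w = dbl_ext (fun b1 b2 =>
    dbl_ext (fun a1 a2 => tens (commutator a1 b1) (commutator a2 b2)) x) w.
Proof. exact: exchange_dbl_ext. Qed.

Lemma dbl_ext_commutator a b u v :
  dbl_ext (fun a1 a2 => tens (commutator a1 u) (commutator a2 v)) (tens a b)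
  = tens (commutator a u) (commutator b v).
Proof.
rewrite dbl_ext_tens // => u' c x y.
  by rewrite commutator_is_linear tens_linl.
by rewrite commutator_is_linear tens_linr.
Qed.

Lemma rho_d_tens a u v : rho_d a (tens u v) = tens (action2 a u) v + tens u (action2 a v).
Proof.
rewrite /rho_d dbl_linE dbl_ext_tens // => u' c x y.
  by rewrite action2_is_linear !tens_linl; apply/ffunP => K; rewrite !ffunE /GRing.scale /=; ring.
by rewrite action2_is_linear !tens_linr; apply/ffunP => K; rewrite !ffunE /GRing.scale /=; ring.
Qed.

HB.instance Definition _ a :=
  GRing.isLinear.Build R (dbl R n) (dbl R n) _ (rho_d a) (dbl_ext_is_linear _).

(** The square of A (x) 1 + 1 (x) A; its cross term is what produces the sharp
    product. *)
Lemma rho_d2 a w : rho_d a (rho_d a w) = dbl_ext (fun u v =>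
    tens (action2 a (action2 a u)) v + 2 *: tens (action2 a u) (action2 a v)
    + tens u (action2 a (action2 a v))) w.
Proof.
rewrite [rho_d a w]dbl_linE linear_dbl_ext.
apply: eq_bigr => I _; apply: eq_bigr => J _; congr (_ *: _) => /=.
rewrite linearD /= !rho_d_tens.
by apply/ffunP => K; rewrite !ffunE /GRing.scale /=; ring.
Qed.

(** This double form acts as the identity on k-forms; it is g^k / k! in an
    orthonormal coframe. *)
Definition identity_form (k : nat) : dbl R n :=
  \sum_(K : {set 'I_n} | #|K| == k) tens (ebasis R K) (ebasis R K).

Definition euclidean_form : dbl R n := \sum_i tens (one_form R i) (one_form R i).

(** Every set K of k+1 indices is obtained k+1 times as the union of an index and a
    set of k indices, and the two equal signs multiply to 1. *)
Lemma euclidean_form_mul_identity (k : nat) :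
  dbl_mul euclidean_form (identity_form k) = k.+1%:R *: identity_form k.+1.
Proof.
rewrite /euclidean_form dbl_mul_suml.
transitivity (\sum_i \sum_(K : {set 'I_n} | (#|K| == k.+1) && (i \in K)) tens (ebasis R K) (ebasis R K)).
  apply: eq_bigr => i _; rewrite /identity_form linear_sum /=.
  rewrite [RHS](reindex_onto (fun K => i |: K) (fun K => K :\ i)) /=; last first.
    by move=> K /andP[_ iK]; rewrite setD1K.
  rewrite [RHS](eq_bigl (fun K : {set 'I_n} => (#|K| == k) && (i \notin K))); last first.
    move=> K; rewrite setU11 andbT; case: (boolP (i \in K)) => iK.
      rewrite andbF; apply/negP => /andP[_ /eqP E]; move: iK; rewrite -E !inE eqxx //.
    by rewrite cardsU1 iK setU1K // eqxx !andbT.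
  rewrite [LHS](bigID (fun K : {set 'I_n} => i \notin K)) /= [X in _ + X]big1 ?addr0 => [|K /andP[_]].
    apply: eq_bigr => K /andP[_ iK]; rewrite dbl_mul_tens -/(eps _ _) eps_ebasis (negbTE iK).
    by rewrite tensZl tensZr scalerA shuffle_sign_sq scale1r.
  rewrite negbK dbl_mul_tens -/(eps _ _) eps_ebasis => ->; exact: linear0.
rewrite (exchange_big_dep (fun K : {set 'I_n} => #|K| == k.+1)) /=; last by move=> i K _ /andP[].
rewrite /identity_form scaler_sumr; apply: eq_bigr => K /eqP cK.
rewrite (eq_bigl (mem K)) => [|i]; last by rewrite cK eqxx.
by rewrite sumr_const cK scaler_nat.
Qed.

Lemma euclidean_form_exp (k : nat) : dbl_exp euclidean_form k = k`!%:R *: identity_form k.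
Proof.
elim: k => [|k IH].
  rewrite fact0 scale1r /dbl_exp /= /identity_form (bigD1 set0) ?cards0 //= big1 ?addr0 //.
  by move=> K; rewrite cards_eq0 => /andP[/eqP ->]; rewrite eqxx.
rewrite /dbl_exp iterS -/(dbl_exp _ _) IH linearZ /= euclidean_form_mul_identity scalerA.
by rewrite factS natrM mulrC.
Qed.

Lemma act_left_tens a b u : act_left u (tens a b) = ext_inner b u *: a.
Proof.
rewrite /act_left dbl_ext_tens // => v c x y; first by rewrite scalerDr !scalerA mulrC.
rewrite scalerA -scalerDl; congr (_ *: _).
rewrite /ext_inner mulr_sumr -big_split; apply: eq_bigr => I _.
by rewrite !ffunE /GRing.scale /=; ring.
Qed.
Lemma act_right_tens a b u : act_right u (tens a b) = ext_inner a u *: b.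
Proof.
rewrite /act_right dbl_ext_tens // => v c x y; last by rewrite scalerDr !scalerA mulrC.
rewrite scalerA -scalerDl; congr (_ *: _).
rewrite /ext_inner mulr_sumr -big_split; apply: eq_bigr => I _.
by rewrite !ffunE /GRing.scale /=; ring.
Qed.

Lemma act_left_identity_mul (k : nat) a b u : act_left u (dbl_mul (identity_form k) (tens a b)) =
  \sum_(K : {set 'I_n} | #|K| == k) ext_inner (wedge (ebasis R K) b) u *: wedge (ebasis R K) a.
Proof.
rewrite /identity_form dbl_mul_suml [LHS]linear_sum; apply: eq_bigr => K _ /=.
by rewrite dbl_mul_tens act_left_tens.
Qed.
Lemma act_right_identity_mul (k : nat) a b u :
  act_right u (dbl_mul (identity_form k) (tens a b)) = act_left u (dbl_mul (identity_form k) (tens b a)).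
Proof.
rewrite act_left_identity_mul.
rewrite /identity_form dbl_mul_suml [LHS]linear_sum; apply: eq_bigr => K _ /=.
by rewrite dbl_mul_tens act_right_tens.
Qed.

Lemma iota_pform p i u : is_pform p.+1 u -> is_pform p (iota_ i u).
Proof.
move=> hu I hI; rewrite iotaE; case: ifP => // iI.
by rewrite hu ?mulr0 // cardsU1 iI.
Qed.

Lemma iota_0form i u : is_pform 0 u -> iota_ i u = 0.
Proof.
move=> hu; apply/ffunP => I; rewrite iotaE ffunE; case: ifP => // iI.
by rewrite hu ?mulr0 // cardsU1 iI.
Qed.

Lemma pform_expand p u : is_pform p u ->
  \sum_(K : {set 'I_n} | #|K| == p) u K *: ebasis R K = u.
Proof.
move=> hu; rewrite [RHS]ext_expand big_mkcond; apply: eq_bigr => K _.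
by case: ifP => // /negbT /hu ->; rewrite scale0r.
Qed.

Lemma wedge_eps i I : wedge (ebasis R I) (one_form R i) = (-1) ^+ #|I| *: eps i (ebasis R I).
Proof. by rewrite /one_form wedge_basisC cards1 muln1. Qed.

(** Contraction with e_K /\ e_j is contraction with e_j followed by reading the
    coefficient at K. The sign of moving e_K past a one-form occurs twice. *)
Lemma act_left_identity_mul11 (k : nat) i j u : is_pform k.+1 u ->
  act_left u (dbl_mul (identity_form k) (tens (one_form R i) (one_form R j))) = eps i (iota_ j u).
Proof.
move=> hu; rewrite act_left_identity_mul -(pform_expand (iota_pform j hu)) [RHS]linear_sum.
apply: eq_bigr => K _; rewrite [RHS]linearZ /= -ext_innerE -ext_inner_eps !wedge_eps.
rewrite scalerA; congr (_ *: _).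
rewrite /ext_inner mulr_suml; apply: eq_bigr => I _; rewrite ffunE /GRing.scale /=.
by rewrite mulrC !mulrA -expr2 sqrr_sign mul1r.
Qed.

Lemma wedge_eps2 i j I :
  wedge (ebasis R I) (wedge (one_form R i) (one_form R j)) = eps i (eps j (ebasis R I)).
Proof.
rewrite wedgeA wedge_eps wedgeZl /eps -wedgeA wedge_eps linearZ /= scalerA.
by rewrite -expr2 sqrr_sign scale1r.
Qed.

Lemma act_left_identity_mul22 (k : nat) i j l m u : is_pform k.+2 u ->
  act_left u (dbl_mul (identity_form k) (tens (wedge (one_form R i) (one_form R j))
                               (wedge (one_form R l) (one_form R m))))
  = eps i (eps j (iota_ m (iota_ l u))).
Proof.
move=> hu; rewrite act_left_identity_mul -(pform_expand (iota_pform m (iota_pform l hu))).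
rewrite [X in eps i X]linear_sum [RHS]linear_sum.
apply: eq_bigr => K _ /=; rewrite [X in eps i X]linearZ [RHS]linearZ /=.
by rewrite -ext_innerE -!ext_inner_eps !wedge_eps2.
Qed.

End DoubleForms.

(** * Algebraic curvature tensors and the pointwise formula *)

Section Sum4.
Variables (R : realType) (n : nat) (V : lmodType R).
Implicit Types f h : 'I_n -> 'I_n -> 'I_n -> 'I_n -> V.

(** Fourfold sums get a name so that permutations of the four indices can be
    written as compositions of the three adjacent transpositions. *)
Definition sum4 f : V := \sum_i \sum_j \sum_k \sum_l f i j k l.

Lemma eq_sum4 f h : (forall i j k l, f i j k l = h i j k l) -> sum4 f = sum4 h.
Proof. by move=> fh; do 4!apply: eq_bigr => ? _. Qed.

Lemma sum4D f h : sum4 (fun i j k l => f i j k l + h i j k l) = sum4 f + sum4 h.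
Proof.
rewrite /sum4 -big_split; apply: eq_bigr => i _; rewrite -big_split.
apply: eq_bigr => j _; rewrite -big_split; apply: eq_bigr => k _.
by rewrite -big_split.
Qed.

Lemma sum4Z c f : sum4 (fun i j k l => c *: f i j k l) = c *: sum4 f.
Proof. by rewrite /sum4; do 4!(rewrite scaler_sumr; apply: eq_bigr => ? _). Qed.

Lemma sum4N f : sum4 (fun i j k l => - f i j k l) = - sum4 f.
Proof. by rewrite -scaleN1r -sum4Z; apply: eq_sum4 => *; rewrite scaleN1r. Qed.

Lemma sum4_swap12 f : sum4 f = sum4 (fun i j k l => f j i k l).
Proof. exact: exchange_big. Qed.

Lemma sum4_swap23 f : sum4 f = sum4 (fun i j k l => f i k j l).
Proof. by apply: eq_bigr => i _; exact: exchange_big. Qed.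

Lemma sum4_swap34 f : sum4 f = sum4 (fun i j k l => f i j l k).
Proof. by apply: eq_bigr => i _; apply: eq_bigr => j _; exact: exchange_big. Qed.

End Sum4.

Lemma linear_sum4 (R : realType) (n : nat) (V V' : lmodType R)
    (h : {linear V -> V'}) (f : 'I_n -> 'I_n -> 'I_n -> 'I_n -> V) :
  h (sum4 f) = sum4 (fun i j k l => h (f i j k l)).
Proof. by rewrite /sum4; do 4!(rewrite linear_sum; apply: eq_bigr => ? _). Qed.

Section Curvature.
Import boot.finset.
Variables (R : realType) (n : nat).
Implicit Types (a b u v : ext R n) (w x y : dbl R n) (i j k l : 'I_n) (I J K : {set 'I_n}).

Notation one := (ebasis R (set0 : {set 'I_n})).

Definition curvature_symmetries (r : 'I_n -> 'I_n -> 'I_n -> 'I_n -> R) : Prop :=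
  [/\ forall i j k l, r i j k l = - r j i k l,
      forall i j k l, r i j k l = - r i j l k
    & forall i j k l, r i j k l + r j k i l + r k i j l = 0].

Definition curvature_form (r : 'I_n -> 'I_n -> 'I_n -> 'I_n -> R) : dbl R n :=
  4^-1 *: sum4 (fun i j k l => r i j k l *:
    tens (wedge (one_form R i) (one_form R j))
         (wedge (one_form R k) (one_form R l))).

Definition form11 (c : 'I_n -> 'I_n -> R) : dbl R n :=
  \sum_j \sum_k c j k *: tens (one_form R j) (one_form R k).

Definition ricci_of (r : 'I_n -> 'I_n -> 'I_n -> 'I_n -> R) j k : R :=
  \sum_i r i j i k.

Variable r : 'I_n -> 'I_n -> 'I_n -> 'I_n -> R.
Hypothesis hr : curvature_symmetries r.

Let Rm := curvature_form r.
Let Ric := form11 (ricci_of r).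

(** The octahedron argument: the Bianchi identity is used at the four cyclic shifts
    of the indices. *)
Lemma pair_symmetry i j k l : r i j k l = r k l i j.
Proof.
case: hr => a1 a2 b.
have := (b i j k l, b j k l i, b k l i j, b l i j k).
have := (a1 i j k l, a1 j k i l, a1 k i j l, a1 j k l i, a1 k l j i, a1 l j k i).
have := (a1 k l i j, a1 l i k j, a1 i k l j, a1 l i j k, a1 i j l k, a1 j l i k).
have := (a2 i j k l, a2 j k i l, a2 k i j l, a2 k l j i, a2 l j k i, a2 l i k j).
move=> [[[[[]]]]] ? ? ? ? ? ? [[[[[]]]]] ? ? ? ? ? ? [[[[[]]]]] ? ? ? ? ? ? [[[]]] ? ? ? ?.
lra.
Qed.

Lemma ricci_ofC j k : ricci_of r j k = ricci_of r k j.
Proof. by apply: eq_bigr => i _; rewrite pair_symmetry. Qed.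

(** The derivation of e_i /\ e_j is a difference of two terms, so a term of the
    left-hand side expands into four; antisymmetry of r makes their sums equal,
    which absorbs the factor 1/4. *)
Lemma action2_curvature u :
  dbl_ext (fun a b => action2 a (action2 b u)) Rm =
  sum4 (fun i j k l => r i j k l *: eps j (iota_ i (eps l (iota_ k u)))).
Proof.
case: hr => a1 a2 _.
have quarter (T T1 T2 T3 : ext R n) :
    T1 = - T -> T2 = - T -> T3 = T -> T = 4^-1 *: (T + - T1 + - T2 + T3).
  move=> -> -> ->; rewrite !opprK; apply/ffunP => I; rewrite !ffunE /GRing.scale /=.
  by field.
pose G i j k l : ext R n := eps j (iota_ i (eps l (iota_ k u))).
rewrite /Rm /curvature_form linearZ /= linear_sum4 /=.
set S := sum4 (fun i j k l => r i j k l *: G i j k l); rewrite -[RHS]/S.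
have s1 : sum4 (fun i j k l => r i j k l *: G j i k l) = - S.
  by rewrite sum4_swap12 -sum4N; apply: eq_sum4 => i j k l; rewrite a1 scaleNr.
have s2 : sum4 (fun i j k l => r i j k l *: G i j l k) = - S.
  by rewrite sum4_swap34 -sum4N; apply: eq_sum4 => i j k l; rewrite a2 scaleNr.
have s3 : sum4 (fun i j k l => r i j k l *: G j i l k) = S.
  rewrite sum4_swap34 sum4_swap12; apply: eq_sum4 => i j k l.
  by rewrite a1 a2 opprK.
transitivity (4^-1 *: (S + - sum4 (fun i j k l => r i j k l *: G j i k l)
   + - sum4 (fun i j k l => r i j k l *: G i j l k)
   + sum4 (fun i j k l => r i j k l *: G j i l k))); last first.
  symmetry; apply: quarter s1 s2 s3.
congr (_ *: _); rewrite -!sum4N -!sum4D; apply: eq_sum4 => i j k l.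
rewrite linearZ /= dbl_ext_tens.
- rewrite !action2_wedge !operator_linearE opprD opprK addrA !scalerDr !scalerN.
  by rewrite [X in X + _ = _]addrAC.
- move=> v c x y; exact: (linearP (action2r (action2 v u))).
- move=> v c x y; rewrite -linearP; congr action2; exact: (linearP (action2r u)).
Qed.

(** The curvature term of the Weitzenboeck formula on ordinary forms: the Ricci
    tensor extended as a derivation, plus a two-body term. *)
Definition weitzenbock_op u : ext R n :=
  \sum_j \sum_k ricci_of r j k *: eps j (iota_ k u)
  + 2^-1 *: sum4 (fun i j k l => r i j k l *: eps i (eps j (iota_ k (iota_ l u)))).

(** Normal ordering of eps iota eps iota by the anticommutation relation gives a
    trace, which is the Ricci term, and a term in eps eps iota iota. In the latter
    only the part of r that is antisymmetric in the indices of the two eps counts,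
    and the Bianchi identity identifies this part. *)
Lemma weitzenbock_forms u :
  dbl_ext (fun a b => action2 a (action2 b u)) Rm = - weitzenbock_op u.
Proof.
case: (hr) => a1 a2 b.
rewrite action2_curvature.
pose X i j k l : ext R n := eps j (eps l (iota_ i (iota_ k u))).
set S := sum4 (fun i j k l => r i j k l *: X i j k l).
have e1 : sum4 (fun i j k l => r i j k l *: eps j (iota_ i (eps l (iota_ k u)))) =
   - (\sum_j \sum_k ricci_of r j k *: eps j (iota_ k u)) - S.
  transitivity (sum4 (fun i j k l => (r i j k l * (i == l)%:R) *: eps j (iota_ k u)) - S).
    rewrite -sum4N -sum4D; apply: eq_sum4 => i j k l.
    rewrite iota_eps !operator_linearE [eps j (_ *: _)]linearZ /X /=.
    by apply/ffunP => I; rewrite !ffunE /GRing.scale /=; ring.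
  congr (_ - _); rewrite sum4_swap12 sum4_swap23 /sum4 -sumrN; apply: eq_bigr => j _.
  rewrite -sumrN; apply: eq_bigr => k _; rewrite /ricci_of -scaleNr -sumrN scaler_suml.
  apply: eq_bigr => i _; rewrite (bigD1 i) //= eqxx mulr1 big1 ?addr0.
    by rewrite -a2.
  by move=> l li; rewrite eq_sym (negbTE li) mulr0 scale0r.
have e2 : S = - sum4 (fun i j k l => r i l k j *: X i j k l).
  rewrite -[RHS]sum4N; apply: (etrans (sum4_swap23 _)); apply: (etrans (sum4_swap34 _)).
  apply: (etrans (sum4_swap23 _)); apply: eq_sum4 => i j k l.
  by rewrite /X eps_anti scalerN.
(* Averaging S with the expression of e2 antisymmetrizes r in j and l. *)
have e3 : S = 2^-1 *: sum4 (fun i j k l => r i j k l *: eps i (eps j (iota_ k (iota_ l u)))).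
  have halve (T T' : ext R n) : T = T' -> T = 2^-1 *: (T + T').
    by move=> <-; apply/ffunP => I; rewrite !ffunE /GRing.scale /=; field.
  apply: (etrans (halve _ _ e2)); congr (_ *: _); rewrite -[X in _ + X]sum4N -[LHS]sum4D.
  symmetry; apply: (etrans (sum4_swap23 _)); apply: (etrans (sum4_swap12 _)).
  apply: (etrans (sum4_swap34 _)); symmetry.
  apply: eq_sum4 => i j k l.
  rewrite -scaleNr -scalerDl /X; congr (_ *: _).
  have := (b i j k l, pair_symmetry j k i l, a2 i l j k, a1 k i j l, pair_symmetry j l i k).
  move=> [[[[]]]] *; lra.
by rewrite e1 e3 /weitzenbock_op opprD.
Qed.

Lemma weitzenbock_op_0form u : is_pform 0 u -> weitzenbock_op u = 0.
Proof.
move=> hu; rewrite /weitzenbock_op big1 ?add0r => [|j _]; last first.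
  by rewrite big1 // => k _; rewrite iota_0form // linear0 scaler0.
rewrite /sum4 big1 ?scaler0 // => i _; rewrite big1 // => j _; rewrite big1 // => k _.
by rewrite big1 // => l _; rewrite (iota_0form l hu) !linear0.
Qed.

Lemma linear_form11 (V : lmodType R) (h : {linear dbl R n -> V}) c :
  h (form11 c) = \sum_j \sum_k c j k *: h (tens (one_form R j) (one_form R k)).
Proof.
rewrite /form11 linear_sum; apply: eq_bigr => j _; rewrite linear_sum.
by apply: eq_bigr => k _; rewrite linearZ.
Qed.

Lemma calN_identity_form p :
  calN (euclidean_form R n) Rm Ric p.+2
  = dbl_mul (identity_form R n p.+1) Ric - 2 *: dbl_mul (identity_form R n p) Rm.
Proof.
rewrite /calN !euclidean_form_exp !dbl_mulZl !scalerA.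
by rewrite -mulrA !mulVf ?pnatr_eq0 -?lt0n ?fact_gt0 // scale1r mulr1.
Qed.

(** Multiplying a (1,1) or (2,2) double form by g^k / k! extends its action to forms
    of higher degree as a one-body or a two-body operator. *)
Lemma act_left_calN p u : is_pform p u ->
  act_left u (calN (euclidean_form R n) Rm Ric p) = weitzenbock_op u.
Proof.
case: p => [|[|p]] hu.
- by rewrite /= linear0 weitzenbock_op_0form.
- rewrite /= /weitzenbock_op (_ : sum4 _ = 0) ?scaler0 ?addr0; last first.
    rewrite /sum4 big1 // => i _; rewrite big1 // => j _; rewrite big1 // => k _.
    rewrite big1 // => l _.
    by rewrite (iota_0form k (iota_pform l hu)) !linear0.
  rewrite linear_form11; apply: eq_bigr => j _; apply: eq_bigr => k _; congr (_ *: _).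
  rewrite /= act_left_tens -(pform_expand (iota_pform k hu)) (big_pred1 set0) => [|K]; last exact: cards_eq0.
  by rewrite linearZ /= -one_formE -ext_innerE -ext_inner_eps -one_formE.
rewrite calN_identity_form linearB /=.
congr (_ + _).
  apply: (etrans (linear_form11 (act_left u \o dbl_mul (identity_form R n p.+1)) _)).
  apply: eq_bigr => j _.
  by apply: eq_bigr => k _; rewrite /= act_left_identity_mul11.
rewrite [act_left u (_ *: _)]linearZ /= /Rm /curvature_form [dbl_mul _ (_ *: _)]linearZ.
rewrite [act_left u (_ *: _)]linearZ /= scalerA.
have -> : act_left u (dbl_mul (identity_form R n p) (sum4 (fun i j k l => r i j k l *:
    tens (wedge (one_form R i) (one_form R j)) (wedge (one_form R k) (one_form R l)))))
  = - sum4 (fun i j k l => r i j k l *: eps i (eps j (iota_ k (iota_ l u)))).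
  apply: (etrans (linear_sum4 (act_left u \o dbl_mul (identity_form R n p)) _)).
  rewrite -[RHS]sum4N; apply: eq_sum4 => i j k l.
  by rewrite linearZ /= act_left_identity_mul22 // iota_anti !operator_linearE scalerN.
rewrite scalerN opprK; congr (_ *: _); by field.
Qed.

(** The double form is symmetric, since the Ricci tensor is and the curvature has
    the pair symmetry. *)
Lemma act_right_calN p u :
  act_right u (calN (euclidean_form R n) Rm Ric p) =
  act_left u (calN (euclidean_form R n) Rm Ric p).
Proof.
have sym11 (f h : {linear dbl R n -> ext R n}) :
    (forall j k, f (tens (one_form R j) (one_form R k)) = h (tens (one_form R k) (one_form R j))) ->
    f Ric = h Ric.
  move=> fh; rewrite !linear_form11 exchange_big; apply: eq_bigr => j _; apply: eq_bigr => k _.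
  by rewrite fh ricci_ofC.
have sym22 (f h : {linear dbl R n -> ext R n}) :
    (forall x y : ext R n, f (tens x y) = h (tens y x)) -> f Rm = h Rm.
  move=> fh; rewrite /Rm /curvature_form !linearZ /=; congr (_ *: _).
  rewrite !linear_sum4; apply: (etrans (sum4_swap23 _)); apply: (etrans (sum4_swap12 _)).
  apply: (etrans (sum4_swap34 _)); apply: (etrans (sum4_swap23 _)).
  by apply: eq_sum4 => i j k l; rewrite !linearZ /= fh pair_symmetry.
case: p => [|[|p]]; first by rewrite /= !linear0.
  by rewrite /=; apply: sym11 => j k /=; rewrite act_left_tens act_right_tens.
rewrite calN_identity_form [LHS]linearB [RHS]linearB /=.
rewrite [act_right u (_ *: _)]linearZ [act_left u (_ *: _)]linearZ /=.
congr (_ - _ *: _).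
  apply: (sym11 (act_right u \o dbl_mul (identity_form R n p.+1))
    (act_left u \o dbl_mul (identity_form R n p.+1))) => j k /=.
  exact: act_right_identity_mul.
apply: (sym22 (act_right u \o dbl_mul (identity_form R n p))
  (act_left u \o dbl_mul (identity_form R n p))) => x y /=.
exact: act_right_identity_mul.
Qed.

(** Spectral decomposition. The curvature form is determined by its values on the
    basis 2-forms, which expand on the eigenbasis. *)
Lemma curvature_form_eigen (A : finType) (E : A -> ext R n) (lam : A -> R) :
  curvature_eigenbasis Rm E lam -> Rm = \sum_al lam al *: tens (E al) (E al).
Proof.
move=> [E2 Eorth Espan Eeig].
have R0 I J : #|I| != 2 -> Rm (I, J) = 0.
  move=> hI.
  have tens0 i j v : tens (wedge (one_form R i) (one_form R j)) v (I, J) = 0.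
    rewrite ffunE /= -/(eps i (one_form R j)) epsE one_formE epsE !ffunE.
    case: ifP => iI; rewrite ?mul0r //; case: ifP => jI; rewrite ?mulr0 ?mul0r //.
    case: eqP => [E0|]; rewrite ?mulr0 ?mul0r //.
    by move: hI; rewrite (cardsD1 i) iI (cardsD1 j) jI E0 cards0.
  rewrite /Rm /curvature_form ffunE /sum4 sum_ffunE big1 ?scaler0 // => i _.
  rewrite sum_ffunE big1 // => j _; rewrite sum_ffunE big1 // => k _.
  by rewrite sum_ffunE big1 // => l _; rewrite ffunE tens0 scaler0.
apply/ffunP => -[I J].
have [hI|hI] := eqVneq #|I| 2; last first.
  rewrite R0 // sum_ffunE big1 // => al _; rewrite !ffunE /= E2 // mul0r scaler0 //.
have p2 : is_pform 2 (ebasis R I).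
  by move=> K hK; rewrite ffunE; case: eqP => // E0; move: hK; rewrite E0 hI.
have [c ec] := Espan _ p2.
(* Pairing the expansion of the basis vector with E al gives its coefficient. *)
have cE al : c al = E al I.
  have : ext_inner (E al) (ebasis R I) = c al.
    rewrite ec linear_sum (bigD1 al) //= big1 => [|be nb]; rewrite linearZ /= Eorth.
      by rewrite eqxx addr0 [LHS]mulr1.
    by rewrite eq_sym (negbTE nb) scaler0.
  move=> <-; rewrite -ext_innerE /ext_inner; apply: eq_bigr => K _; exact: mulrC.
have curv_linear : linear (curv_op Rm).
  move=> d u v; rewrite /curv_op scaler_sumr -big_split; apply: eq_bigr => K _ /=.
  rewrite scaler_sumr -big_split; apply: eq_bigr => L _ /=.
  by rewrite linearP /= scalerA -scalerDl mulrDr mulrCA.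
pose C : {linear ext R n -> ext R n} := HB.pack (curv_op Rm)
  (GRing.isLinear.Build R (ext R n) (ext R n) _ (curv_op Rm) curv_linear).
have : curv_op Rm (ebasis R I) J = Rm (I, J).
  rewrite /curv_op (bigD1 I) //= [X in _ + X]big1 => [|K nK]; last first.
    by apply: big1 => L _; rewrite ext_innerE ebasisE (negbTE nK) mulr0 scale0r.
  rewrite addr0 sum_ffunE (bigD1 J) //= big1 => [|L nL]; rewrite ffunE ext_innerE !ebasisE.
    by rewrite !eqxx mulr1 addr0 [LHS]mulr1.
  by rewrite eq_sym (negbTE nL) scaler0.
move=> <-; rewrite ec -[curv_op Rm]/(C : _ -> _) linear_sum !sum_ffunE.
apply: eq_bigr => al _; rewrite linearZ /= Eeig !ffunE /= cE.
by rewrite /GRing.scale /= mulrCA.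
Qed.

(** Squaring A_E (x) 1 + 1 (x) A_E and summing with weights, the two squares give the
    Weitzenboeck operators of the two factors. The cross term involves
    sum lambda A_E (x) A_E, which is a quarter of the sharp product with the curvature
    since a Clifford commutator with E is twice A_E. *)
Theorem weitzenbock_double_form (A : finType) (E : A -> ext R n) (lam : A -> R)
    p q (W : dbl R n) :
  curvature_eigenbasis Rm E lam -> bidegree p q W ->
  - (2^-1 *: \sum_al lam al *: rho_d (E al) (rho_d (E al) W)) =
  2^-1 *: (dbl_compose W (calN (euclidean_form R n) Rm Ric p)
           + dbl_compose (calN (euclidean_form R n) Rm Ric q) W)
  - 4^-1 *: dbl_sharp Rm W.
Proof.
move=> hE hW; have eRm := curvature_form_eigen hE; have [E2 _ _ _] := hE.
have AA u : \sum_al lam al *: action2 (E al) (action2 (E al) u) = - weitzenbock_op u.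
  rewrite -weitzenbock_forms eRm linear_sum; apply: eq_bigr => al _.
  rewrite linearZ /= dbl_ext_tens //.
  - move=> v c x y; exact: (linearP (action2r (action2 v u))).
  - move=> v c x y; rewrite -linearP; congr action2; exact: (linearP (action2r u)).
rewrite dbl_compose_act_left dbl_compose_act_right dbl_sharp_swap.
under eq_bigr do rewrite rho_d2.
have dblZ c f : c *: dbl_ext f W = dbl_ext (fun a b => c *: f a b : dbl R n) W.
  by rewrite (linear_dbl_ext (GRing.scale c)).
have dblD f h : dbl_ext f W + dbl_ext h W = dbl_ext (fun a b => f a b + h a b : dbl R n) W.
  rewrite /dbl_ext -big_split; apply: eq_bigr => I _ /=; rewrite -big_split.
  by apply: eq_bigr => J _ /=; rewrite scalerDr.
have dbl_sum (f : A -> ext R n -> ext R n -> dbl R n) :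
    \sum_al dbl_ext (f al) W = dbl_ext (fun a b => \sum_al f al a b) W.
  rewrite /dbl_ext exchange_big; apply: eq_bigr => I _ /=; rewrite exchange_big.
  by apply: eq_bigr => J _ /=; rewrite scaler_sumr.
under eq_bigr do rewrite dblZ.
rewrite dbl_sum -!scaleNr !dblZ !dblD !dblZ !dblD.
apply: (eq_dbl_ext hW) => I J hI hJ.
set u := ebasis R I; set v := ebasis R J.
have hu : is_pform p u.
  by move=> K hK; rewrite ffunE; case: eqP => // E0; move: hK; rewrite E0 hI eqxx.
have hv : is_pform q v.
  by move=> K hK; rewrite ffunE; case: eqP => // E0; move: hK; rewrite E0 hJ eqxx.
have -> : dbl_ext (fun a1 a2 => tens (commutator a1 u) (commutator a2 v)) Rm =
   4 *: \sum_al lam al *: tens (action2 (E al) u) (action2 (E al) v).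
  rewrite eRm linear_sum scaler_sumr; apply: eq_bigr => al _.
  rewrite linearZ /= dbl_ext_commutator !commutator_2form // tensZl tensZr !scalerA.
  congr (_ *: _); ring.
rewrite act_right_calN !act_left_calN //.
set X := \sum_al lam al *: tens (action2 (E al) u) (action2 (E al) v).
have -> : \sum_al lam al *: (tens (action2 (E al) (action2 (E al) u)) v
     + 2 *: tens (action2 (E al) u) (action2 (E al) v)
     + tens u (action2 (E al) (action2 (E al) v)))
   = - tens (weitzenbock_op u) v + 2 *: X - tens u (weitzenbock_op v).
  have -> : - tens (weitzenbock_op u) v
      = \sum_al lam al *: tens (action2 (E al) (action2 (E al) u)) v.
    rewrite -scaleN1r -tensZl scaleN1r -AA tens_suml.
    by apply: eq_bigr => al _; rewrite tensZl.
  have -> : - tens u (weitzenbock_op v)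
      = \sum_al lam al *: tens u (action2 (E al) (action2 (E al) v)).
    rewrite -scaleN1r -tensZr scaleN1r -AA tens_sumr.
    by apply: eq_bigr => al _; rewrite tensZr.
  rewrite /X scaler_sumr -!big_split; apply: eq_bigr => al _ /=.
  by rewrite !scalerDr; congr (_ + _ + _); rewrite !scalerA mulrC.
move: (tens (weitzenbock_op u) v) (tens u (weitzenbock_op v)) X => P Q X.
by apply/ffunP => K; rewrite !ffunE /GRing.scale /=; field.
Qed.

End Curvature.

(** * Symmetry of second derivatives *)

Section Schwarz.
Local Open Scope classical_set_scope.
Variables (R : realType) (V : normedModType R).
Implicit Types (f : V -> R^o) (a u v y : V).

(** Restriction to a line reduces directional derivatives to derivatives of
    functions of one real variable, to which the mean value theorem applies. *)
Lemma is_derive_line f a u (s : R) : derivable f (a + s *: u) u ->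
  is_derive (s : R^o) (1 : R^o) (fun t : R^o => f (a + t *: u) : R^o) ('D_u f (a + s *: u)).
Proof.
move=> df.
have E : (fun h : R => h^-1 *: (((fun t : R^o => f (a + t *: u) : R^o) \o shift (s : R^o)) (h *: (1 : R^o))
                       - f (a + s *: u))) =
   (fun h => h^-1 *: ((f \o shift (a + s *: u)) (h *: u) - f (a + s *: u))).
  apply/funext => h; rewrite /= /shift /=; congr (_ *: (f _ - _)).
  by rewrite [h *: 1]mulr1 scalerDl addrCA.
by split; rewrite ?/derivable ?/derive E.
Qed.

Lemma MVT_line f a u (h : R) : 0 < h ->
  (forall s, 0 <= s <= h -> derivable f (a + s *: u) u) ->
  exists2 s, 0 <= s <= h & f (a + h *: u) - f a = 'D_u f (a + s *: u) * h.
Proof.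
move=> h0 df.
have [||s sh E] := @MVT R (fun t => f (a + t *: u)) (fun t => 'D_u f (a + t *: u)) 0 h h0.
- move=> s; rewrite in_itv /= => /andP[/ltW s0 /ltW sh].
  by apply: is_derive_line; apply: df; rewrite s0.
- apply: derivable_within_continuous => s; rewrite in_itv /= => sh.
  by have [] := is_derive_line (df _ sh).
- exists s; first by move: sh; rewrite in_itv /= => /andP[/ltW -> /ltW ->].
  by move: E; rewrite scale0r addr0 subr0.
Qed.

(** The mean value theorem in the direction u for the increment in the direction v,
    then in the direction v for the derivative along u. *)
Lemma second_difference f a u v (h : R) : 0 < h ->
  (forall s t, 0 <= s <= h -> 0 <= t <= h ->
     derivable f (a + s *: u + t *: v) u /\
     derivable ('D_u f) (a + s *: u + t *: v) v) ->
  exists s t, [/\ 0 <= s <= h, 0 <= t <= h &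
    f (a + h *: u + h *: v) - f (a + h *: u) - f (a + h *: v) + f a
    = 'D_v ('D_u f) (a + s *: u + t *: v) * h ^+ 2].
Proof.
move=> h0 df; have hh : 0 <= h <= h by rewrite lexx ltW.
have h00 : 0 <= (0 : R) <= h by rewrite lexx ltW.
have d1 s : 0 <= s <= h -> derivable f (a + h *: v + s *: u) u.
  by move=> sh; rewrite addrAC; exact: (df s h sh hh).1.
have d0 s : 0 <= s <= h -> derivable f (a + s *: u) u.
  by move=> sh; have := (df s 0 sh h00).1; rewrite scale0r addr0.
pose F (s : R) := f (a + h *: v + s *: u) - f (a + s *: u).
pose dF (s : R) := 'D_u f (a + h *: v + s *: u) - 'D_u f (a + s *: u).
have iF s : 0 <= s <= h -> is_derive (s : R^o) (1 : R^o) (F : R^o -> R^o) (dF s).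
  move=> sh; apply: is_deriveB; apply: is_derive_line; [exact: d1|exact: d0].
have [||s sh E] := @MVT R F dF 0 h h0.
- by move=> s; rewrite in_itv /= => /andP[/ltW s0 /ltW sh]; apply: iF; rewrite s0.
- apply: derivable_within_continuous => s; rewrite in_itv /= => sh.
  by have [] := iF _ sh.
have {}sh : 0 <= s <= h by move: sh; rewrite in_itv /= => /andP[/ltW -> /ltW ->].
have [t th Et] := @MVT_line ('D_u f) (a + s *: u) v h h0 (fun t th => (df s t sh th).2).
exists s, t; split=> //.
move: E; rewrite /F /dF scale0r !addr0 subr0.
rewrite (addrAC a (h *: v) (s *: u)) Et (addrAC a (h *: v) (h *: u)) => E.
have -> : 'D_v ('D_u f) (a + s *: u + t *: v) * h ^+ 2 =
  'D_v ('D_u f) (a + s *: u + t *: v) * h * h by rewrite expr2 mulrA.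
by rewrite -E; ring.
Qed.

(** The second difference is symmetric in u and v, so it is a value of both mixed
    derivatives at points close to a; continuity at a concludes. *)
Theorem derive_commute f a u v :
  (\forall y \near a, [/\ derivable f y u, derivable f y v,
     derivable ('D_u f) y v & derivable ('D_v f) y u]) ->
  {for a, continuous ('D_v ('D_u f))} -> {for a, continuous ('D_u ('D_v f))} ->
  'D_v ('D_u f) a = 'D_u ('D_v f) a.
Proof.
move=> df c1 c2; apply/eqP; rewrite -subr_eq0 -normr_eq0.
apply/eqP/le_anti; rewrite normr_ge0 andbT; apply/ler_addgt0Pl => e e0; rewrite addr0.
have e20 : 0 < e / 2 by rewrite divr_gt0.
have n1 : \forall y \near a, `|'D_v ('D_u f) a - 'D_v ('D_u f) y| < e / 2.
  by move/cvgrPdist_lt : c1 => /(_ _ e20).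
have n2 : \forall y \near a, `|'D_u ('D_v f) a - 'D_u ('D_v f) y| < e / 2.
  by move/cvgrPdist_lt : c2 => /(_ _ e20).
have : \forall y \near a, [/\ derivable f y u, derivable f y v,
     derivable ('D_u f) y v & derivable ('D_v f) y u] /\
   (`|'D_v ('D_u f) a - 'D_v ('D_u f) y| < e / 2 /\ `|'D_u ('D_v f) a - 'D_u ('D_v f) y| < e / 2).
  exact: (filterI df (filterI n1 n2)).
move=> /nbhs_normP[d /= d0 hd].
(* The 1 keeps the denominator positive when u and v both vanish. *)
pose h := d / (2 * (`|u| + `|v| + 1)).
have N0 : 0 < 2 * (`|u| + `|v| + 1) by rewrite mulr_gt0 // ltr_wpDl // addr_ge0.
have h0 : 0 < h by rewrite divr_gt0.
have hd' s t : 0 <= s <= h -> 0 <= t <= h -> `|a - (a + s *: u + t *: v)| < d.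
  move=> /andP[s0 sh] /andP[t0 th].
  have -> : a - (a + s *: u + t *: v) = - (s *: u + t *: v).
    by rewrite -addrA opprD addrA subrr add0r.
  rewrite normrN; apply: (le_lt_trans (ler_normD _ _)); rewrite !normrZ (ger0_norm s0) (ger0_norm t0).
  apply: (@le_lt_trans _ _ (h * (`|u| + `|v|))).
    by rewrite mulrDr lerD // ler_wpM2r.
  rewrite /h mulrAC ltr_pdivrMr // ltr_pM2l //.
  have := normr_ge0 u; have := normr_ge0 v; lra.
have [s [t [sh th E1]]] := @second_difference f a u v h h0 (fun s t sh th =>
   let: conj (And4 p1 p2 p3 p4) _ := hd _ (hd' s t sh th) in conj p1 p3).
have hd2 s' t' : 0 <= s' <= h -> 0 <= t' <= h -> `|a - (a + s' *: v + t' *: u)| < d.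
  by move=> ? ?; rewrite addrAC; exact: hd'.
have [t' [s' [th' sh' E2]]] := @second_difference f a v u h h0 (fun s t sh th =>
   let: conj (And4 p1 p2 p3 p4) _ := hd _ (hd2 s t sh th) in conj p2 p4).
have EE : 'D_v ('D_u f) (a + s *: u + t *: v) = 'D_u ('D_v f) (a + t' *: v + s' *: u).
  apply: (@mulIf _ (h ^+ 2)); first by rewrite expf_neq0 // gt_eqF.
  apply: (etrans (esym E1)); apply: etrans E2.
  by rewrite (addrAC a (h *: v)); congr (_ + _); exact: addrAC.
have [_ [l1 _]] := hd _ (hd' s t sh th).
have [_ [_ l2]] := hd _ (hd2 t' s' th' sh').
rewrite EE in l1.
set A := 'D_v _ a in l1 *; set B := 'D_u _ a in l2 *; set C := 'D_u _ _ in l1 l2.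
have -> : A - B = (A - C) - (B - C) by ring.
apply: (le_trans (ler_normB _ _)); rewrite [e]splitr; exact: lerD (ltW l1) (ltW l2).
Unshelve. all: by end_near.
Qed.

End Schwarz.

(** * Derivatives of sums, determinants and inverse matrices *)

Section DeriveSum.
Variables (R : realType) (V : normedModType R) (T : Type).
Implicit Types (a v : V) (s : seq T) (P : pred T).

Lemma is_derive_big_sum (f : T -> V -> R^o) (df : T -> R^o) a v s P :
  (forall t, is_derive a v (f t) (df t)) ->
  is_derive a v (fun y => \sum_(t <- s | P t) f t y : R^o) (\sum_(t <- s | P t) df t).
Proof.
move=> hf; elim: s => [|t s IH].
  rewrite big_nil (_ : (fun _ => _) = cst 0); first exact: is_derive_cst.
  by apply/funext => y; rewrite big_nil.
rewrite big_cons; case: ifP => Pt.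
  rewrite (_ : (fun _ => _) = f t + (fun y => \sum_(t <- s | P t) f t y : R^o)).
    exact: is_deriveD.
  by apply/funext => y; rewrite big_cons Pt.
rewrite (_ : (fun _ => _) = (fun y => \sum_(t <- s | P t) f t y : R^o)) //.
by apply/funext => y; rewrite big_cons Pt.
Qed.

Lemma derivable_big_sum (f : T -> V -> R^o) a v s P :
  (forall t, derivable (f t) a v) ->
  derivable (fun y => \sum_(t <- s | P t) f t y : R^o) a v.
Proof.
move=> hf; have [] // := @is_derive_big_sum f (fun t => 'D_v (f t) a) a v s P _.
Qed.

Lemma derivable_big_prod (f : T -> V -> R^o) a v s P :
  (forall t, derivable (f t) a v) ->
  derivable (fun y => \prod_(t <- s | P t) f t y : R^o) a v.
Proof.
move=> hf; elim: s => [|t s IH].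
  rewrite (_ : (fun _ => _) = cst 1); first exact: derivable_cst.
  by apply/funext => y; rewrite big_nil.
case Pt : (P t).
  rewrite (_ : (fun _ => _) = f t * (fun y => \prod_(t <- s | P t) f t y : R^o)).
    exact: derivableM.
  by apply/funext => y; rewrite big_cons Pt.
rewrite (_ : (fun _ => _) = (fun y => \prod_(t <- s | P t) f t y : R^o)) //.
by apply/funext => y; rewrite big_cons Pt.
Qed.

End DeriveSum.

Section DeriveMatrix.
Variables (R : realType) (V : normedModType R).
Implicit Types (a v : V).

Lemma derivable_det m (A : V -> 'M[R]_m) a v :
  (forall i j, derivable (fun y => A y i j : R^o) a v) ->
  derivable (fun y => \det (A y) : R^o) a v.
Proof.
move=> hA; apply: derivable_big_sum => s.
rewrite (_ : (fun _ => _) = cst ((-1) ^+ odd_perm s : R^o) * (fun y => \prod_i A y i (fun_of_perm s i) : R^o)) //.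
by apply: derivableM => //; apply: derivable_big_prod => i.
Qed.

(** By Cramer's rule the entries of the inverse are rational in those of the
    matrix. *)
Lemma derivable_invmx m (A : V -> 'M[R]_m) a v i j :
  (\forall y \near a, A y \in unitmx) ->
  (forall i j, derivable (fun y => A y i j : R^o) a v) ->
  derivable (fun y => invmx (A y) i j : R^o) a v.
Proof.
move=> hu hA.
apply: (@near_eq_derivable _ _ _ (fun y => (\det (A y))^-1 * cofactor (A y) j i : R^o)).
  near=> y; have uy : A y \in unitmx by near: y.
  by rewrite /invmx uy !mxE.
rewrite (_ : (fun _ => _) = (fun y => (\det (A y))^-1 : R^o) * (fun y => cofactor (A y) j i : R^o)) //.
apply: derivableM.
  apply: derivableV; last exact: derivable_det.
  by have := nbhs_singleton hu; rewrite unitmxE unitfE.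
rewrite (_ : (fun _ => _) = cst ((-1) ^+ (j + i) : R^o) *
   (fun y => \det (row' j (col' i (A y))) : R^o)) //.
apply: derivableM => //; apply: derivable_det => k l.
by rewrite (_ : (fun _ => _) = (fun y => A y (lift j k) (lift i l) : R^o)) //; apply/funext => y; rewrite !mxE.
Unshelve. all: by end_near. Qed.

End DeriveMatrix.

(** * Curvature of a metric on an open subset of R^n *)

Section LocalCurvature.
Local Open Scope classical_set_scope.
Variables (R : realType) (n : nat) (U : set 'rV[R]_n).
Hypothesis Uo : open U.
Variable G : 'I_n -> 'I_n -> 'rV[R]_n -> R^o.
Hypothesis Gsmooth : forall i j, smooth_on U (G i j).
Hypothesis Gsym : forall i j y, U y -> G i j y = G j i y.
Let Gm y : 'M[R]_n := \matrix_(i, j) G i j y.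
Hypothesis Gunit : forall y, U y -> Gm y \in unitmx.

(** Christoffel symbols of the first kind, that is with the upper index lowered. *)
Definition christoffel_low i j l : 'rV[R]_n -> R^o := fun y =>
  2^-1 * (partial i (G j l) y + partial j (G i l) y - partial l (G i j) y).

Definition christoffel_loc i j k : 'rV[R]_n -> R^o := fun y =>
  2^-1 * \sum_l invmx (Gm y) k l *
    (partial i (G j l) y + partial j (G i l) y - partial l (G i j) y).

Let Gam := christoffel_loc.
Let L := christoffel_low.

Lemma eq_partial (f h : 'rV[R]_n -> R^o) i y :
  (forall z, U z -> f z = h z) -> U y -> partial i f y = partial i h y.
Proof.
move=> fh Uy; apply: near_eq_derive.
have : \forall z \near y, U z by exact: open_nbhs_nbhs.
by apply: filterS => z /fh.
Qed.

Lemma christoffel_locC i j k y : U y -> Gam i j k y = Gam j i k y.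
Proof.
move=> Uy; rewrite /Gam /christoffel_loc; congr (_ * _); apply: eq_bigr => l _.
rewrite (eq_partial l (Gsym i j) Uy); congr (_ * (_ - _)); exact: addrC.
Qed.

Lemma lower_christoffel_loc i j l y : U y -> \sum_m Gam i j m y * G m l y = L i j l y.
Proof.
move=> Uy; rewrite /Gam /christoffel_loc.
pose C p : R := partial i (G j p) y + partial j (G i p) y - partial p (G i j) y.
transitivity (2^-1 * \sum_p (\sum_m Gm y l m * invmx (Gm y) m p) * C p).
  under eq_bigr do rewrite -mulrA mulr_suml.
  rewrite -mulr_sumr exchange_big; congr (_ * _); apply: eq_bigr => p _.
  rewrite mulr_suml; apply: eq_bigr => m _; rewrite /C mxE (Gsym l m Uy); ring.
have e p : \sum_m Gm y l m * invmx (Gm y) m p = (l == p)%:R.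
  by have := mulmxV (Gunit Uy) => /matrixP /(_ l p); rewrite [LHS]mxE [RHS]mxE.
rewrite (bigD1 l) //= [X in _ * (_ + X)]big1 => [|p pl]; first by rewrite e eqxx addr0 mul1r.
by rewrite e eq_sym (negbTE pl) mul0r.
Qed.

Lemma metric_derivable i j y v : U y -> derivable (G i j) y (delta_mx 0 v).
Proof. by move=> Uy; have [_ /(_ v)[h _]] := Gsmooth i j 1; exact: h. Qed.

Lemma partial_metric_derivable i j k y v : U y -> derivable (partial k (G i j)) y (delta_mx 0 v).
Proof. by move=> Uy; have [_ /(_ k)[_ [_ /(_ v)[h _]]]] := Gsmooth i j 2; exact: h. Qed.

Lemma partial_metricC i j k l y : U y ->
  partial k (partial l (G i j)) y = partial l (partial k (G i j)) y.
Proof.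
move=> Uy; apply: derive_commute.
- have : \forall z \near y, U z by exact: open_nbhs_nbhs.
  apply: filterS => z Uz; split.
  + exact: metric_derivable.
  + exact: metric_derivable.
  + exact: (@partial_metric_derivable i j l).
  + exact: (@partial_metric_derivable i j k).
- by have [_ /(_ l)[_ [_ /(_ k)[_ [h _]]]]] := Gsmooth i j 2; exact: h.
- by have [_ /(_ k)[_ [_ /(_ l)[_ [h _]]]]] := Gsmooth i j 2; exact: h.
Qed.

Lemma christoffel_numerator_derivable i j l y v : U y ->
  derivable (fun y => partial i (G j l) y + partial j (G i l) y
                      - partial l (G i j) y : R^o) y (delta_mx 0 v).
Proof.
move=> Uy; apply: derivableB; first apply: derivableD; exact: partial_metric_derivable.
Qed.

Lemma christoffel_loc_derivable i j k y v : U y -> derivable (Gam i j k) y (delta_mx 0 v).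
Proof.
move=> Uy.
rewrite (_ : Gam i j k = cst (2^-1 : R^o) * (fun y => \sum_l invmx (Gm y) k l *
    (partial i (G j l) y + partial j (G i l) y - partial l (G i j) y) : R^o)) //.
apply: derivableM; first exact: derivable_cst.
apply: derivable_big_sum => l.
rewrite (_ : (fun _ => _) = (fun y => invmx (Gm y) k l : R^o) *
  (fun y => partial i (G j l) y + partial j (G i l) y - partial l (G i j) y : R^o)) //.
apply: derivableM; last exact: christoffel_numerator_derivable.
apply: derivable_invmx => [|p q].
  have : \forall z \near y, U z by exact: open_nbhs_nbhs.
  by apply: filterS => z; exact: Gunit.
rewrite (_ : (fun _ => _) = G p q); first exact: metric_derivable.
by apply/funext => z; rewrite mxE.
Qed.

Definition riem_loc i j k l y : R :=
  partial i (Gam j k l) y - partial j (Gam i k l) y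
  + \sum_m (Gam j k m y * Gam i m l y - Gam i k m y * Gam j m l y).

(** The connection is torsion-free: the derivatives of the symbols cancel in pairs,
    and so do the quadratic terms. *)
Lemma riem_loc_bianchi i j k l y : U y ->
  riem_loc i j k l y + riem_loc j k i l y + riem_loc k i j l y = 0.
Proof.
move=> Uy.
have C p q z : U z -> Gam p q l z = Gam q p l z by exact: christoffel_locC.
rewrite /riem_loc (eq_partial i (C j k) Uy) (eq_partial j (C i k) Uy) (eq_partial k (C j i) Uy).
have cyc (a b d s1 s2 s3 : R) : s1 + s2 + s3 = 0 ->
    a - b + s1 + (b - d + s2) + (d - a + s3) = 0.
  by move=> s0; rewrite -[RHS]s0; ring.
apply: cyc; rewrite -!big_split /= big1 // => m _.
have cyc0 (p q r : R) : p - q + (q - r) + (r - p) = 0 by ring.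
rewrite (christoffel_locC j k m Uy) (christoffel_locC i k m Uy) (christoffel_locC j i m Uy).
exact: cyc0.
Qed.

Lemma partial_metric i k l y : U y -> partial i (G k l) y = L i k l y + L i l k y.
Proof.
move=> Uy; rewrite /L /christoffel_low (eq_partial i (Gsym l k) Uy).
have half2 (a b d : R) : a = 2^-1 * (a + b - d) + 2^-1 * (a + d - b) by field.
exact: half2.
Qed.

Lemma partial_christoffel_low i j k l y : U y -> partial i (L j k l) y =
  2^-1 * (partial i (partial j (G k l)) y + partial i (partial k (G j l)) y
          - partial i (partial l (G j k)) y).
Proof.
move=> Uy; rewrite {1}/partial.
rewrite (_ : L j k l = cst (2^-1 : R^o) * (partial j (G k l) + partial k (G j l) - partial l (G j k))) //.
rewrite deriveM; [|exact: derivable_cst|].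
  rewrite derive_cst scaler0 addr0 deriveB;
    [|apply: derivableD; exact: partial_metric_derivable|exact: partial_metric_derivable].
  by rewrite deriveD //; exact: partial_metric_derivable.
by apply: derivableB; [apply: derivableD|]; exact: partial_metric_derivable.
Qed.

(** The Leibniz rule for the lowered symbols; solving it for the derivatives of the
    symbols of the second kind avoids computing the derivative of the inverse metric. *)
Lemma partial_sum_christoffel i j k l y : U y ->
  \sum_m partial i (Gam j k m) y * G m l y =
  partial i (L j k l) y - \sum_m Gam j k m y * partial i (G m l) y.
Proof.
move=> Uy; apply/eqP; rewrite eq_sym subr_eq; apply/eqP.
have E z : U z -> L j k l z = \sum_m Gam j k m z * G m l z.
  by move=> Uz; rewrite lower_christoffel_loc.
rewrite (eq_partial i E Uy) -big_split /=.
have hm m : is_derive y (delta_mx 0 i) (Gam j k m * G m l : _ -> R^o)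
    (partial i (Gam j k m) y * G m l y + Gam j k m y * partial i (G m l) y).
  have h1 : derivable (Gam j k m) y (delta_mx 0 i) by exact: christoffel_loc_derivable.
  have h2 : derivable (G m l) y (delta_mx 0 i) by exact: metric_derivable.
  apply: DeriveDef; first exact: derivableM.
  by rewrite deriveM // addrC; congr (_ + _); rewrite mulrC.
by have [_ <-] := is_derive_big_sum (index_enum 'I_n) predT hm.
Qed.

(** The component g(R(d_i, d_j) d_k, d_l), with the last two indices in the order
    opposite to that of [riem_dn]. *)
Definition riem_low i j k l y : R := \sum_m riem_loc i j k m y * G m l y.

Lemma riem_lowE i j k l y : U y -> riem_low i j k l y =
  partial i (L j k l) y - partial j (L i k l) y
  - \sum_m Gam j k m y * L i l m y + \sum_m Gam i k m y * L j l m y.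
Proof.
move=> Uy; rewrite /riem_low /riem_loc.
have quad p q r s : \sum_m (\sum_t Gam p q t y * Gam r t m y) * G m s y
    = \sum_m Gam p q m y * L r m s y.
  under eq_bigr do rewrite mulr_suml.
  rewrite exchange_big; apply: eq_bigr => t _; rewrite -lower_christoffel_loc // mulr_sumr.
  by apply: eq_bigr => m _; rewrite mulrA.
transitivity (\sum_m partial i (Gam j k m) y * G m l y
    - \sum_m partial j (Gam i k m) y * G m l y
    + (\sum_m (\sum_t Gam j k t y * Gam i t m y) * G m l y
       - \sum_m (\sum_t Gam i k t y * Gam j t m y) * G m l y)).
  rewrite -[X in _ = X + _]sumrB -[X in _ = _ + X]sumrB -[RHS]big_split.
  apply: eq_bigr => m _ /=.
  by rewrite [X in (_ + X) * _]sumrB mulrDl mulrBl mulrBl.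
have split4 p q r s : \sum_m Gam p q m y * partial r (G m s) y =
   \sum_m Gam p q m y * L r m s y + \sum_m Gam p q m y * L r s m y.
  by rewrite -big_split; apply: eq_bigr => m _; rewrite partial_metric // mulrDr.
have regroup (p1 p2 s1 s2 q1 q2 a b x1 x2 y1 y2 : R) :
    p1 = a - s1 -> s1 = x1 + x2 -> p2 = b - s2 -> s2 = y1 + y2 -> q1 = x1 -> q2 = y1 ->
    p1 - p2 + (q1 - q2) = a - b - x2 + y2.
  by move=> -> -> -> -> -> ->; ring.
exact: (regroup _ _ _ _ _ _ _ _ _ _ _ _ (partial_sum_christoffel i j k l Uy) (split4 j k i l)
  (partial_sum_christoffel j i k l Uy) (split4 i k j l) (quad j k i l) (quad i k j l)).
Qed.

Lemma christoffel_quad i j k l y : U y ->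
  \sum_m Gam i j m y * L k l m y = \sum_m Gam k l m y * L i j m y.
Proof.
move=> Uy.
under eq_bigr do rewrite -lower_christoffel_loc // mulr_sumr.
rewrite exchange_big; apply: eq_bigr => p _; rewrite -lower_christoffel_loc // mulr_sumr.
by apply: eq_bigr => m _; rewrite (Gsym p m Uy); ring.
Qed.

(** This is the compatibility of the connection with the metric. The quadratic terms
    cancel by [christoffel_quad], and the sum of the derivatives of the lowered
    symbols is a commutator of second derivatives of the metric. *)
Lemma riem_low_antisym i j k l y : U y -> riem_low i j k l y = - riem_low i j l k y.
Proof.
move=> Uy; apply/eqP; rewrite -addr_eq0 !riem_lowE //.
rewrite (christoffel_quad j k i l Uy) (christoffel_quad i k j l Uy) !partial_christoffel_low //.
have sw p q r s : partial p (partial q (G r s)) y = partial p (partial q (G s r)) y.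
  by apply: eq_partial => // z Uz; apply: eq_partial => // z' Uz'; exact: Gsym.
rewrite (sw i j l k) (sw j i l k) (partial_metricC k l i j Uy).
have regroup (a b d e f q1 q2 : R) :
  2^-1 * (a + b - d) - 2^-1 * (a + e - f) - q1 + q2
  + (2^-1 * (a + d - b) - 2^-1 * (a + f - e) - q2 + q1) = 0 by field.
apply/eqP; exact: regroup.
Qed.

End LocalCurvature.

(** * Curvature of a Riemannian manifold in a chart *)

Section ChartCurvature.
Local Open Scope classical_set_scope.
Variables (R : realType) (n : nat) (M : manifold R n) (g : metric M) (c : chart M).
Implicit Types (i j k l m : 'I_n) (x : M).

Let U := chart_img c.
Let G i j : 'rV[R]_n -> R^o := fun y => g c (chart_inv c y) ([set i]%SET, [set j]%SET).

Lemma chart_imgP y : U y -> dom c (chart_inv c y) /\ chart_map c (chart_inv c y) = y.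
Proof. by move=> [x dx <-]; rewrite chart_mapK. Qed.

Lemma dom_chart_img x : dom c x -> U (chart_map c x).
Proof. by move=> dx; exists x. Qed.

Lemma chart_metric_smooth i j : smooth_on U (G i j).
Proof. exact: df_smooth. Qed.

Lemma gdn_sym x i j : dom c x -> gdn g c x i j = gdn g c x j i.
Proof. by move=> dx; have /matrixP /(_ i j) := met_sym g dx; rewrite [LHS]mxE /gdn => ->. Qed.

Lemma chart_metric_sym i j y : U y -> G i j y = G j i y.
Proof.
move=> /chart_imgP[dy _]; have := gdn_sym i j dy.
by rewrite /gdn /gram !mxE.
Qed.

(** A vector in the kernel would have length zero. *)
Lemma gdn_unit x : dom c x -> gdn g c x \in unitmx.
Proof.
move=> dx; rewrite unitmxE unitfE; apply/negP => /det0P[v v0 vg].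
have := met_pos g dx v0; rewrite -/(gdn g c x) vg mul0mx mxE ltxx //.
Qed.

Lemma chart_metric_matrix y : \matrix_(i, j) G i j y = gdn g c (chart_inv c y).
Proof. by apply/matrixP => i j; rewrite !mxE. Qed.

Lemma chart_metric_unit y : U y -> (\matrix_(i, j) G i j y : 'M[R]_n) \in unitmx.
Proof. by move=> /chart_imgP[dy _]; rewrite chart_metric_matrix gdn_unit. Qed.

Lemma dchart_gdn i j k y : U y ->
  dchart c k (fun z => gdn g c z i j) (chart_inv c y) = partial k (G i j) y.
Proof.
move=> /chart_imgP[_ Ey]; rewrite /dchart Ey; congr (partial k _ y).
by apply/funext => z; rewrite /gdn /gram mxE.
Qed.

Lemma christoffelE i j k y : U y ->
  christoffel g c i j k (chart_inv c y) = christoffel_loc G i j k y.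
Proof.
move=> Uy; rewrite /christoffel /christoffel_loc; congr (_ * _).
by apply: eq_bigr => l _; rewrite !dchart_gdn // /gup -chart_metric_matrix.
Qed.

Lemma riem_upE i j k l x : dom c x ->
  riem_up g c i j k l x = riem_loc G i j k l (chart_map c x).
Proof.
move=> dx; have Ux := dom_chart_img dx.
have ex m1 m2 m3 : christoffel g c m1 m2 m3 x = christoffel_loc G m1 m2 m3 (chart_map c x).
  by rewrite -christoffelE // chart_mapK.
have edx m m1 m2 m3 : dchart c m (christoffel g c m1 m2 m3) x
    = partial m (christoffel_loc G m1 m2 m3) (chart_map c x).
  rewrite /dchart; apply: (eq_partial (@chart_img_open _ _ _ c) m _ Ux) => z Uz.
  exact: christoffelE.
rewrite /riem_up /riem_loc !edx; congr (_ + _).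
by apply: eq_bigr => m _; rewrite !ex.
Qed.

Lemma riem_dnE i j k l x : dom c x ->
  riem_dn g c i j k l x = riem_low G i j l k (chart_map c x).
Proof.
move=> dx; apply: eq_bigr => m _; rewrite riem_upE //; congr (_ * _).
by rewrite /G chart_mapK // /gdn /gram mxE.
Qed.

Lemma riem_dn_symmetries x : dom c x ->
  curvature_symmetries (fun i j k l => riem_dn g c i j k l x).
Proof.
move=> dx; have Ux := dom_chart_img dx.
have a2 i j k l : riem_dn g c i j k l x = - riem_dn g c i j l k x.
  rewrite !riem_dnE //.
  exact: (riem_low_antisym (@chart_img_open _ _ _ c) chart_metric_smooth chart_metric_sym chart_metric_unit).
split=> // [i j k l|i j k l].
  rewrite /riem_dn -sumrN; apply: eq_bigr => m _; rewrite -mulNr; congr (_ * _).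
  rewrite /riem_up opprD opprB -sumrN; congr (_ + _).
  by apply: eq_bigr => p _; rewrite opprB.
rewrite a2 (a2 j k) (a2 k i) -!opprD /riem_dn -!big_split /= big1 ?oppr0 // => m _.
rewrite -!mulrDl !riem_upE // (riem_loc_bianchi (@chart_img_open _ _ _ c) chart_metric_sym) ?mul0r //.
Qed.

End ChartCurvature.

(** * Linear changes of coframe *)

Section Substitution.
Import boot.finset.
Variables (R : realType) (n : nat).
Implicit Types (a b u v : ext R n) (w : dbl R n) (i j k l : 'I_n) (I J K : {set 'I_n}).
Notation one := (ebasis R (set0 : {set 'I_n})).
Variable B : 'M[R]_n.

Let subst_form i : ext R n := \sum_j B i j *: one_form R j.

Lemma ext_subst_is_linear : linear (ext_subst B).
Proof.
move=> c u v; rewrite /ext_subst scaler_sumr -big_split; apply: eq_bigr => I _ /=.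
by rewrite !ffunE scalerDl scalerA.
Qed.
HB.instance Definition _ :=
  GRing.isLinear.Build R (ext R n) (ext R n) _ (ext_subst B) ext_subst_is_linear.

Lemma ext_subst_basis I :
  ext_subst B (ebasis R I) = \big[@wedge R n/one]_(i <- enum I) subst_form i.
Proof.
rewrite /ext_subst (bigD1 I) //= [X in _ + X]big1 => [|J nJ]; rewrite ebasisE.
  by rewrite eqxx scale1r addr0.
by rewrite (negbTE nJ) scale0r.
Qed.

Lemma wedge_one u : wedge u one = u.
Proof.
rewrite {2}(ext_expand u) {1}(ext_expand u) wedge_suml; apply: eq_bigr => I _.
rewrite wedgeZl wedge_ebasis wedge_basisE disjoint_sym -setI_eq0 set0I eqxx setU0.
by rewrite /shuffle_sign /inversions big1 ?expr0 ?scale1r // => i _; rewrite big_set0.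
Qed.

Lemma ext_subst_one_form i : ext_subst B (one_form R i) = subst_form i.
Proof. by rewrite /one_form ext_subst_basis enum_set1 big_cons big_nil wedge_one. Qed.

Lemma subst_form_wedge u i : wedge (subst_form i) u = \sum_j B i j *: eps j u.
Proof. by rewrite /subst_form wedge_suml; apply: eq_bigr => j _; rewrite wedgeZl. Qed.

Lemma subst_form_anti i j :
  wedge (subst_form i) (subst_form j) = - wedge (subst_form j) (subst_form i).
Proof.
rewrite -[subst_form j in LHS]wedge_one -[subst_form i in RHS]wedge_one !subst_form_wedge.
have E k l : \sum_m B k m *: eps m (\sum_p B l p *: eps p one)
    = \sum_m \sum_p (B k m * B l p) *: eps m (eps p one).
  apply: eq_bigr => m _; rewrite [eps m _]linear_sum scaler_sumr; apply: eq_bigr => p _.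
  by rewrite linearZ /= scalerA.
rewrite !E exchange_big -[RHS]sumrN; apply: eq_bigr => m _; rewrite -[RHS]sumrN.
by apply: eq_bigr => p _; rewrite eps_anti scalerN mulrC.
Qed.

(** [ext_subst] is defined by products in increasing order of the indices, so the
    case of increasing indices is immediate and the others follow by
    antisymmetry. *)
Lemma ext_subst_wedge i j :
  ext_subst B (wedge (one_form R i) (one_form R j)) = wedge (subst_form i) (subst_form j).
Proof.
have lt_case i' j' : (i' < j')%N ->
    ext_subst B (wedge (one_form R i') (one_form R j')) = wedge (subst_form i') (subst_form j').
  move=> ij; have -> : wedge (one_form R i') (one_form R j') = ebasis R [set i'; j'].
    rewrite -/(eps i' _) /one_form eps_ebasis inE -val_eqE /= ltn_eqF //.
    rewrite /shuffle_sign /inversions !big_set1 /= [(j' < i')%N]ltnNge (ltnW ij) /=.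
    by rewrite expr0 scale1r.
  rewrite ext_subst_basis; have -> : enum [set i'; j'] = [:: i'; j'].
    apply: (@irr_sorted_eq _ (fun a b : 'I_n => (a < b)%N)).
    - by move=> ? ? ?; exact: ltn_trans.
    - by move=> a; exact: ltnn.
    - by have := sorted_enum_set [set i'; j']; rewrite sorted_map.
    - by rewrite /= ij.
    - by move=> a; rewrite mem_enum !inE.
  by rewrite !big_cons big_nil wedge_one.
have [ij|ij|/val_inj ->] := ltngtP i j.
- exact: lt_case.
- rewrite subst_form_anti -lt_case // -linearN; congr ext_subst.
  by rewrite -/(eps i _) -/(eps j _) !one_formE eps_anti.
- have half0 (u : ext R n) : u = - u -> u = 0.
    move=> /eqP; rewrite -subr_eq0 opprK -mulr2n -scaler_nat scaler_eq0 pnatr_eq0 /=.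
    by move/eqP.
  rewrite (half0 _ (subst_form_anti j j)) -/(eps j _) one_formE eps_twice; exact: linear0.
Qed.

Lemma eps_pform p i u : is_pform p u -> is_pform p.+1 (eps i u).
Proof.
move=> hu I hI; rewrite epsE; case: ifP => // iI.
rewrite hu ?mulr0 //; apply: contra hI => /eqP <-.
by rewrite (cardsD1 i I) iI.
Qed.

Lemma ext_subst_pform I : is_pform #|I| (ext_subst B (ebasis R I)).
Proof.
rewrite ext_subst_basis cardE; elim: (enum I) => [|i s IH].
  by rewrite big_nil => J hJ; rewrite ebasisE; case: (J =P set0) hJ => [->|_ _] //; rewrite cards0.
rewrite big_cons subst_form_wedge => J hJ; rewrite sum_ffunE big1 // => j _.
by rewrite ffunE (eps_pform j IH) // scaler0.
Qed.

Lemma dbl_subst_is_linear : linear (dbl_subst B).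
Proof. exact: dbl_ext_is_linear. Qed.
HB.instance Definition _ :=
  GRing.isLinear.Build R (dbl R n) (dbl R n) _ (dbl_subst B) dbl_subst_is_linear.

Lemma dbl_subst_tens u v : dbl_subst B (tens u v) = tens (ext_subst B u) (ext_subst B v).
Proof.
rewrite /dbl_subst dbl_linE dbl_ext_tens // => u' c x y.
  by rewrite ext_subst_is_linear tens_linl.
by rewrite ext_subst_is_linear tens_linr.
Qed.

Lemma dbl_subst_bidegree p q w : bidegree p q w -> bidegree p q (dbl_subst B w).
Proof.
move=> hw I J hIJ; rewrite /dbl_subst /dbl_lin sum_ffunE big1 // => I' _.
rewrite sum_ffunE big1 // => J' _; rewrite !ffunE /=.
have [[E1 E2]|E] := eqVneq (#|I'|, #|J'|) (p, q); last by rewrite hw // scale0r.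
move: hIJ; rewrite xpair_eqE negb_and => /orP[hI|hJ].
  by rewrite (ext_subst_pform (I := I')) ?E1 // mul0r scaler0.
by rewrite (ext_subst_pform (I := J')) ?E2 // mulr0 scaler0.
Qed.

End Substitution.

(** * Orthonormal frames *)

Section Frames.
Import boot.finset.
Variables (R : realType) (n : nat).
Implicit Types (w : dbl R n) (i j k l : 'I_n) (I J K : {set 'I_n}).

Lemma sum4_pair (V : lmodType R) (f : 'I_n -> 'I_n -> 'I_n -> 'I_n -> V) :
  sum4 f = \sum_(p : ('I_n * 'I_n) * ('I_n * 'I_n)) f p.1.1 p.1.2 p.2.1 p.2.2.
Proof.
rewrite /sum4 pair_big -(pair_big predT predT
  (fun p q : 'I_n * 'I_n => f p.1 p.2 q.1 q.2)) /=.
by apply: eq_bigr => p _; rewrite pair_big.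
Qed.

Lemma exchange_sum4 (V : lmodType R)
  (f : 'I_n -> 'I_n -> 'I_n -> 'I_n -> 'I_n -> 'I_n -> 'I_n -> 'I_n -> V) :
  sum4 (fun i j k l => sum4 (f i j k l)) =
  sum4 (fun a b c d => sum4 (fun i j k l => f i j k l a b c d)).
Proof.
rewrite [LHS]sum4_pair [RHS]sum4_pair.
under eq_bigr => p _ do rewrite [sum4 _]sum4_pair.
rewrite exchange_big; apply: eq_bigr => q _ /=.
by rewrite sum4_pair.
Qed.

Variable F : 'M[R]_n.

(** The components of a covariant tensor in the frame given by the rows of F. *)
Definition frame_tensor4 (r : 'I_n -> 'I_n -> 'I_n -> 'I_n -> R) a b c d : R :=
  sum4 (fun i j k l => F a i * F b j * (F c k * F d l) * r i j k l : R^o).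

Lemma frame_tensor4_symmetries r :
  curvature_symmetries r -> curvature_symmetries (frame_tensor4 r).
Proof.
move=> [a1 a2 b]; split=> [p q s t|p q s t|p q s t]; rewrite /frame_tensor4.
- rewrite -[RHS](@sum4N R n R^o); apply: (etrans (sum4_swap12 _)); apply: eq_sum4 => i j k l.
  by rewrite a1; ring.
- rewrite -[RHS](@sum4N R n R^o); apply: (etrans (sum4_swap34 _)); apply: eq_sum4 => i j k l.
  by rewrite a2; ring.
- have rot1 (f : _ -> _ -> _ -> _ -> R^o) :
      sum4 f = sum4 (fun i j k l : 'I_n => f j k i l).
    by rewrite [LHS]sum4_swap23 [LHS]sum4_swap12.
  have rot2 (f : _ -> _ -> _ -> _ -> R^o) :
      sum4 f = sum4 (fun i j k l : 'I_n => f k i j l) by rewrite [RHS]rot1.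
  apply: (etrans (congr2 _ (congr2 _ erefl (rot1 _)) (rot2 _))).
  rewrite -!sum4D /sum4 big1 // => i _; rewrite big1 // => j _; rewrite big1 // => k _.
  rewrite big1 // => l _.
  have factor (u1 u2 u3 u4 y1 y2 y3 : R) : y1 + y2 + y3 = 0 ->
      u1 * u2 * (u3 * u4) * y1 + u2 * u3 * (u1 * u4) * y2 + u3 * u1 * (u2 * u4) * y3 = 0.
    by move=> y0; rewrite -[RHS](mulr0 (u1 * u2 * (u3 * u4))) -y0; ring.
  exact: factor (b i j k l).
Qed.

Lemma subst_wedge_frame i j :
  wedge (\sum_a F^T i a *: one_form R a) (\sum_b F^T j b *: one_form R b) =
  \sum_a \sum_b (F a i * F b j) *: wedge (one_form R a) (one_form R b).
Proof.
rewrite wedge_suml; apply: eq_bigr => a _.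
rewrite wedgeZl [wedge _ (\sum_b _)]linear_sum scaler_sumr.
by apply: eq_bigr => b _; rewrite linearZ /= scalerA !mxE.
Qed.

Lemma in_frame_curvature_form r :
  in_frame F (curvature_form r) = curvature_form (frame_tensor4 r).
Proof.
rewrite /in_frame /curvature_form linearZ /=; congr (_ *: _).
rewrite linear_sum4.
transitivity (sum4 (fun i j k l => sum4 (fun a b c d =>
   (F a i * F b j * (F c k * F d l) * r i j k l) *:
   (tens (wedge (one_form R a) (one_form R b)) (wedge (one_form R c) (one_form R d))
    : dbl R n)))).
  apply: eq_sum4 => i j k l.
  rewrite linearZ /= dbl_subst_tens !ext_subst_wedge !subst_wedge_frame.
  rewrite tens_suml scaler_sumr; apply: eq_bigr => a _.
  rewrite tens_suml scaler_sumr; apply: eq_bigr => b _.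
  rewrite tensZl tens_sumr !scaler_sumr; apply: eq_bigr => c _.
  rewrite tens_sumr !scaler_sumr; apply: eq_bigr => d _.
  by rewrite tensZr !scalerA; congr (_ *: _); ring.
rewrite exchange_sum4; apply: eq_sum4 => a b c d.
rewrite /frame_tensor4 /sum4.
do 4!(rewrite scaler_suml; apply: eq_bigr => ? _).
by [].
Qed.

Lemma in_frame_form11 (s : 'I_n -> 'I_n -> R) :
  in_frame F (form11 s) = form11 (fun a b => \sum_i \sum_j F a i * F b j * s i j).
Proof.
rewrite /in_frame linear_form11 /form11.
transitivity (\sum_i \sum_j \sum_a \sum_b (F a i * F b j * s i j) *:
   (tens (one_form R a) (one_form R b) : dbl R n)).
  apply: eq_bigr => i _; apply: eq_bigr => j _.
  rewrite /= dbl_subst_tens !ext_subst_one_form tens_suml scaler_sumr.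
  apply: eq_bigr => a _; rewrite tensZl tens_sumr !scaler_sumr; apply: eq_bigr => b _.
  by rewrite tensZr !scalerA !mxE; congr (_ *: _); ring.
apply: (etrans (sum4_swap23 _)); apply: (etrans (sum4_swap12 _)).
apply: (etrans (sum4_swap34 _)); apply: (etrans (sum4_swap23 _)).
apply: eq_bigr => a _; apply: eq_bigr => b _.
rewrite scaler_suml; apply: eq_bigr => i _; rewrite scaler_suml.
by apply: eq_bigr => j _.
Qed.

Lemma bidegree11 w : bidegree 1 1 w -> w = form11 (fun i j => w ([set i], [set j])).
Proof.
move=> hw; apply/ffunP => -[I J]; rewrite /form11 sum_ffunE.
have [/andP[/cards1P[i ->] /cards1P[j ->]]|hIJ] := boolP ((#|I| == 1%N) && (#|J| == 1%N)).
  rewrite (bigD1 i) //= [X in _ + X]big1 => [|k nk].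
    rewrite addr0 sum_ffunE (bigD1 j) //= big1 => [|k nk]; rewrite !ffunE /=.
      by rewrite !eqxx mulr1 addr0 [RHS]mulr1.
    by rewrite (inj_eq set1_inj) eq_sym (eqtype.inj_eq set1_inj) (negbTE nk) mulr0 scaler0.
  rewrite sum_ffunE big1 // => l _; rewrite !ffunE /=.
  by rewrite (inj_eq set1_inj) eq_sym (negbTE nk) mul0r scaler0.
rewrite hw; last by rewrite xpair_eqE.
rewrite big1 // => i _; rewrite sum_ffunE big1 // => j _; rewrite !ffunE /=.
case: eqP => [E1|]; last by rewrite mul0r scaler0.
case: eqP => [E2|]; last by rewrite mulr0 scaler0.
by move: hIJ; rewrite E1 E2 !cards1 eqxx.
Qed.

Lemma form11_delta : form11 (fun a b => (a == b)%:R) = euclidean_form R n.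
Proof.
apply: eq_bigr => i _; rewrite (bigD1 i) //= big1 => [|j nj].
  by rewrite eqxx scale1r addr0.
by rewrite eq_sym (negbTE nj) scale0r.
Qed.

Section AtPoint.
Variables (M : manifold R n) (g : metric M) (c : chart M) (x : M).
Hypotheses (dx : dom c x) (hF : orthonormal_frame g c x F).

Let r := frame_tensor4 (fun i j k l => riem_dn g c i j k l x).

Lemma in_frame_metric : in_frame F (g c x) = euclidean_form R n.
Proof.
rewrite -form11_delta [g c x]bidegree11; last by move=> I J; exact: df_degree.
rewrite in_frame_form11; congr form11; apply/funext => a; apply/funext => b.
have := hF => /matrixP /(_ a b); rewrite [in RHS]mxE => <-.
rewrite mxE exchange_big; apply: eq_bigr => j _; rewrite [(F *m _) a j]mxE mulr_suml.
by apply: eq_bigr => i _; rewrite !mxE; ring.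
Qed.

Lemma in_frame_riemann : in_frame F (riemann g c x) = curvature_form r.
Proof. by rewrite -in_frame_curvature_form. Qed.

(** The rows of F being orthonormal, the sum over a frame of F a i * F a k is the
    inverse metric, so the trace over the frame is the trace of the curvature
    endomorphism. *)
Lemma in_frame_ricci : in_frame F (ricci g c x) = form11 (ricci_of r).
Proof.
rewrite [ricci g c x](_ : _ = form11 (fun j k => \sum_i riem_up g c i j k i x)) //.
rewrite in_frame_form11; congr form11; apply/funext => b; apply/funext => d.
have FF m i : \sum_k gdn g c x m k * (\sum_a F a i * F a k) = (m == i)%:R.
  have h1 : F^T *m (F *m gdn g c x) = 1%:M by apply: mulmx1C; exact: hF.
  have := mulmx1C (etrans (esym (mulmxA _ _ _)) h1) => /matrixP /(_ m i).
  rewrite [LHS]mxE [RHS]mxE => <-; apply: eq_bigr => k _; congr (_ * _).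
  by rewrite mxE; apply: eq_bigr => a _; rewrite mxE mulrC.
have tr j l : \sum_i \sum_k (\sum_a F a i * F a k) * riem_dn g c i j k l x
    = \sum_i riem_up g c i j l i x.
  apply: eq_bigr => i _; rewrite /riem_dn.
  under eq_bigr do rewrite mulr_sumr.
  rewrite exchange_big.
  have term m : \sum_k (\sum_a F a i * F a k) * (riem_up g c i j l m x * gdn g c x m k)
      = riem_up g c i j l m x * (m == i)%:R.
    by rewrite -FF mulr_sumr; apply: eq_bigr => k _; ring.
  rewrite (eq_bigr _ (fun m _ => term m)) (bigD1 i) //= big1 => [|m mi].
    by rewrite eqxx mulr1 addr0.
  by rewrite (negbTE mi) mulr0.
rewrite /ricci_of /r /frame_tensor4.
transitivity (\sum_j \sum_l \sum_i \sum_k \sum_a F a i * F b j * (F a k * F d l) * riem_dn g c i j k l x).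
  apply: eq_bigr => j _; apply: eq_bigr => l _; rewrite -tr mulr_sumr; apply: eq_bigr => i _.
  rewrite mulr_sumr; apply: eq_bigr => k _; rewrite mulr_suml mulr_sumr.
  by apply: eq_bigr => a _; ring.
have s1 (f : 'I_n -> 'I_n -> 'I_n -> 'I_n -> R^o) :
   \sum_j \sum_l \sum_i \sum_k f i j k l = sum4 f.
  apply: (etrans (sum4_swap23 _)); apply: (etrans (sum4_swap12 _)).
  exact: (sum4_swap34 (fun i j l k => f i j k l)).
rewrite (s1 (fun i j k l => \sum_a F a i * F b j * (F a k * F d l) * riem_dn g c i j k l x)).
rewrite sum4_pair exchange_big; apply: eq_bigr => a _.
exact: (esym (sum4_pair (V := R^o) _)).
Qed.

Lemma frame_curvature_symmetries : curvature_symmetries r.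
Proof. by apply: frame_tensor4_symmetries; exact: riem_dn_symmetries. Qed.

End AtPoint.
End Frames.

Theorem corollary6p3 (R : realType) (n : nat) (M : manifold R n) (g : metric M)
    (p q : nat) (w : double_form M p q)
    (c : chart M) (x : M) (F : 'M[R]_n)
    (A : finType) (E : A -> ext R n) (lam : A -> R) :
  dom c x -> orthonormal_frame g c x F ->
  curvature_eigenbasis (in_frame F (riemann g c x)) E lam ->
  let W := in_frame F (w c x) in
  let Rm := in_frame F (riemann g c x) in
  let N := calN (in_frame F (g c x)) Rm (in_frame F (ricci g c x)) in
  lichnerowicz g c (w c) x F E lam =
    in_frame F (rough_laplacian g c (w c) x)
    + 2^-1 *: (dbl_compose W (N p) + dbl_compose (N q) W)
    - 4^-1 *: dbl_sharp Rm W.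
Proof.
move=> dx hF hE W Rm N.
have hW : bidegree p q W.
  by apply: dbl_subst_bidegree => I J; exact: df_degree.
have sym := frame_curvature_symmetries F g dx.
move: hE; rewrite /N /Rm in_frame_riemann in_frame_metric // in_frame_ricci // => hE.
rewrite /lichnerowicz -/W -[RHS]addrA; congr (_ + _).
exact: (weitzenbock_double_form sym hE hW).
Qed.
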